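(* Let $d\ge 2$ and $m\ge 1$ be integers, and let $k,r$ be the non-negative integers with $m=k\,Z(d)+r$ and $0\le r<Z(d)$. Suppose that either $d\ge m$, or $d<m$ and $d\le 6$, or $d<m$ and $Z(d)\le m<2d$. Then \[ f_{\triangle}(d,m)=\begin{cases} dm+k\lfloor d/2\rfloor & \text{if } r<d,\\ dm+k\lfloor d/2\rfloor+r-d+1 & \text{if } r\ge d.\end{cases} \] Moreover, a graph in $\mathcal{G}_{\triangle}(d,m)$ can be constructed as the disjoint union of $k$ copies of $C_d$ together with (i) one copy of $A_d$ if $r\ge d$, or (ii) $r$ copies of the $d$-star $K_{1,d}$ if $r<d$. Here $C_d$ is a triangle-free, factor-critical graph with matching number $Z(d)$ that is $d$-regular if $d$ is even and almost $d$-regular if $d$ is odd, and $A_d$ is the graph on $2d+1$ vertices obtained from the cycle of length five by replacing its five vertices, in cyclic order, by independent sets of sizes $1,1,d-1,d-1,1$, with all edges present between the sets corresponding to consecutive vertices of the cycle and no other edges.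
   Context: All graphs are finite, simple and undirected. A graph is triangle-free if it has no three pairwise adjacent vertices. $\Delta(G)$ is the maximum degree and $\nu(G)$ the matching number of $G$. For positive integers $d,m$, $\mathbb{M}_{\triangle}(d,m)$ is the set of triangle-free graphs $G$ with $\Delta(G)\le d$ and $\nu(G)\le m$, and $f_{\triangle}(d,m)$ is the maximum number of edges of a graph in $\mathbb{M}_{\triangle}(d,m)$. A graph in $\mathbb{M}_{\triangle}(d,m)$ with $f_{\triangle}(d,m)$ edges and no isolated vertices is called edge-extremal. $\mathcal{G}_{\triangle}(d,m)$ is the set of edge-extremal graphs in $\mathbb{M}_{\triangle}(d,m)$ that have the maximum possible number of connected components isomorphic to the $d$-star $K_{1,d}$. A graph $G$ is factor-critical if $G-v$ has a perfect matching for every vertex $v$. A graph is almost $d$-regular if one vertex has degree $d-1$ and all other vertices have degree $d$. For $d\ge 2$, $Z(d)$ is the smallest positive integer $n$ such that there exists a triangle-free factor-critical graph $G$ with $\nu(G)=n$ that is $d$-regular (if $d$ is even) or almost $d$-regular (if $d$ is odd). *)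

(* Defs.v *)
From HB Require Import structures.
From mathcomp Require Import all_boot.
From mathcomp Require Import boolp zify.

Set Implicit Arguments.
Unset Strict Implicit.
Unset Printing Implicit Defensive.

Record sgraph := SGraph {
  vertex :> finType;
  adj : rel vertex;
  adj_sym : symmetric adj;
  adj_irr : irreflexive adj }.

Notation "x -- y" := (adj x y) (at level 30, no associativity).

Section Invariants.
Variable G : sgraph.
Implicit Types (x y z : G) (M : {set {set G}}).

Definition deg x : nat := #|[set y | x -- y]|.
Definition max_degree : nat := \max_(x : G) deg x.

Definition edges : {set {set G}} := [set [set p.1; p.2] | p : G * G & p.1 -- p.2].

Definition matching M : bool := (M \subset edges) && trivIset M.
Definition matching_number : nat := \max_(M | matching M) #|M|.
Definition perfect_matching M : bool := matching M && (cover M == [set: G]).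

Definition triangle_free : Prop := forall x y z, ~ [/\ x -- y, y -- z & x -- z].
Definition no_isolated : Prop := forall x, 0 < deg x.

Definition regular d : Prop := forall x, deg x = d.
Definition almost_regular d : Prop :=
  exists x, deg x = d.-1 /\ forall y, y != x -> deg y = d.

End Invariants.

Section Induced.
Variables (G : sgraph) (S : {set G}).
Let ind_adj : rel {x : G | x \in S} := fun u v => val u -- val v.
Fact induced_sym : symmetric ind_adj.
Proof. by move=> u v; rewrite /ind_adj adj_sym. Qed.
Fact induced_irr : irreflexive ind_adj.
Proof. by move=> u; rewrite /ind_adj adj_irr. Qed.
Definition induced : sgraph := SGraph induced_sym induced_irr.
End Induced.

Definition factor_critical (G : sgraph) : Prop :=
  forall v : G, exists M, @perfect_matching (induced [set~ v]) M.

Definition isomorphic (G H : sgraph) : Prop :=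
  exists2 f : G -> H, bijective f & forall x y, (f x -- f y) = (x -- y).

Definition components (G : sgraph) : {set {set G}} :=
  [set [set y | connect (@adj G) x y] | x : G].

Section Copies.
Variables (k : nat) (G : sgraph).
Let copies_adj : rel ('I_k * G) := fun u v => (u.1 == v.1) && (u.2 -- v.2).
Fact copies_sym : symmetric copies_adj.
Proof. by move=> u v; rewrite /copies_adj eq_sym adj_sym. Qed.
Fact copies_irr : irreflexive copies_adj.
Proof. by move=> u; rewrite /copies_adj adj_irr andbF. Qed.
Definition copies : sgraph := SGraph copies_sym copies_irr.
End Copies.

Section DisjointUnion.
Variables (G H : sgraph).
Let dunion_adj : rel (G + H) := fun u v =>
  match u, v with
  | inl x, inl y => x -- y
  | inr x, inr y => x -- y
  | _, _ => false
  end.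
Fact dunion_sym : symmetric dunion_adj.
Proof. by case=> x [] y //=; rewrite adj_sym. Qed.
Fact dunion_irr : irreflexive dunion_adj.
Proof. by case=> x /=; rewrite adj_irr. Qed.
Definition dunion : sgraph := SGraph dunion_sym dunion_irr.
End DisjointUnion.

Section Star.
Variable d : nat.
Let star_adj : rel (option 'I_d) := fun u v => (u == None) (+) (v == None).
Fact star_sym : symmetric star_adj.
Proof. by move=> u v; rewrite /star_adj addbC. Qed.
Fact star_irr : irreflexive star_adj.
Proof. by move=> u; rewrite /star_adj addbb. Qed.
(* The star with centre None. *)
Definition star : sgraph := SGraph star_sym star_irr.
End Star.

Section Blowup.
Variables (G : sgraph) (s : G -> nat).
Let blowup_adj : rel {x : G & 'I_(s x)} := fun u v => tag u -- tag v.
Fact blowup_sym : symmetric blowup_adj.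
Proof. by move=> u v; rewrite /blowup_adj adj_sym. Qed.
Fact blowup_irr : irreflexive blowup_adj.
Proof. by move=> u; rewrite /blowup_adj adj_irr. Qed.
Definition blowup : sgraph := SGraph blowup_sym blowup_irr.
End Blowup.

Section Cycle5.
Let cycle5_adj : rel 'I_5 := fun i j => (j == ordS i) || (i == ordS j).
Fact cycle5_sym : symmetric cycle5_adj.
Proof. by move=> i j; rewrite /cycle5_adj orbC. Qed.
Fact cycle5_irr : irreflexive cycle5_adj.
Proof. by case; do 5?case. Qed.
Definition cycle5 : sgraph := SGraph cycle5_sym cycle5_irr.
End Cycle5.

Definition Agraph (d : nat) : sgraph :=
  @blowup cycle5 (fun i : 'I_5 => nth 0 [:: 1; 1; d.-1; d.-1; 1] i).

Definition Mtri (d m : nat) (G : sgraph) : Prop :=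
  [/\ triangle_free G, max_degree G <= d & matching_number G <= m].

Lemma matching_number_attained (G : sgraph) :
  exists2 M : {set {set G}}, matching M & #|M| = matching_number G.
Proof.
have [|M hM eM] := @eq_bigmax_cond _ (@matching G) (fun M => #|M|).
  apply/card_gt0P; exists set0; rewrite unfold_in /matching sub0set /=.
  by apply/trivIsetP => A B; rewrite inE.
by exists M.
Qed.

Lemma leq_matching_number (G : sgraph) (M : {set {set G}}) :
  matching M -> #|M| <= matching_number G.
Proof. exact: (@leq_bigmax_cond _ (@matching G) (fun M : {set {set G}} => #|M|)). Qed.

Lemma edgeP (G : sgraph) (e : {set G}) :
  reflect (exists x y : G, x -- y /\ e = [set x; y]) (e \in edges G).
Proof.
apply: (iffP imsetP) => [[[x y] /=]|[x [y [xy ->]]]].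
  by rewrite inE /= => xy ->; exists x, y.
by exists (x, y); rewrite ?inE.
Qed.

Lemma card_edge (G : sgraph) (e : {set G}) : e \in edges G -> #|e| = 2.
Proof.
move=> /edgeP[x [y [xy ->]]]; rewrite cards2.
by case: eqP xy => // ->; rewrite adj_irr.
Qed.

Lemma card_cover_matching (G : sgraph) (M : {set {set G}}) :
  matching M -> #|cover M| = #|M| * 2.
Proof.
case/andP => /subsetP sM /eqP <-; rewrite -sum_nat_const.
by apply: eq_bigr => e /sM /card_edge.
Qed.

Lemma card_edges_le (d m : nat) (G : sgraph) :
  Mtri d m G -> #|edges G| <= m * 2 * d.
Proof.
move=> [_ hd hm].
have [M mM cM] := matching_number_attained G.
have cC := card_cover_matching mM.
have sub : edges G \subset
    \bigcup_(x in cover M) [set [set x; y] | y in [set y | x -- y]].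
  apply/subsetP => e eE; have [x [y [xy def_e]]] := edgeP _ eE.
  have [xM|xM] := boolP (x \in cover M).
    by apply/bigcupP; exists x => //; apply/imsetP; exists y; rewrite ?inE.
  have [yM|yM] := boolP (y \in cover M).
    apply/bigcupP; exists y => //; apply/imsetP; exists x.
      by rewrite inE adj_sym.
    by rewrite def_e setUC.
  have disj A : A \in M -> [disjoint e & A].
    move=> AM; rewrite disjoint_subset; apply/subsetP => z; rewrite def_e !inE.
    by case/orP => /eqP ->; [apply: contraNN xM | apply: contraNN yM] => h;
      apply/bigcupP; exists A.
  have eM : e \notin M.
    apply: contraNN xM => eM; apply/bigcupP; exists e => //.
    by rewrite def_e !inE eqxx.
  suff: #|e |: M| <= #|M| by rewrite cardsU1 eM ltnn.
  rewrite cM; apply: leq_matching_number.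
  have/andP[sM tM] := mM; apply/andP; split.
    by rewrite subUset sub1set eE.
  apply/trivIsetP => A B; rewrite !inE.
  case/orP => [/eqP->|AM] /orP[/eqP->|BM] AB; rewrite ?eqxx // in AB *.
  - exact: disj.
  - by rewrite disjoint_sym disj.
  - exact: (trivIsetP tM).
apply: leq_trans (subset_leq_card sub) _.
apply: (@leq_trans (\sum_(x in cover M) d)).
  elim/big_rec2: _ => [|x n A _ le]; first by rewrite cards0.
  rewrite (leq_trans (leq_card_setU _ _)) // leq_add //.
  rewrite (leq_trans (leq_imset_card _ _)) //.
  by apply: leq_trans hd; exact: (@leq_bigmax _ (@deg G) x).
by rewrite sum_nat_const cC cM !leq_mul2r hm !orbT.
Qed.

Section FTri.
Variables d m : nat.
Let attained n : bool := `[< exists2 G, Mtri d m G & #|edges G| = n >].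

Fact ftri_ex : exists n, attained n.
Proof.
exists #|edges (copies 0 (star 0))|; apply/asboolP.
exists (copies 0 (star 0)) => //; split.
- by move=> [[]].
- by apply/bigmax_leqP => -[[]].
- apply/bigmax_leqP => M /card_cover_matching.
  suff -> : #|cover M| = 0 by lia.
  by apply: eq_card0 => -[[]].
Qed.

Fact ftri_bound n : attained n -> n <= m * 2 * d.
Proof. by move=> /asboolP[G hG <-]; apply: card_edges_le. Qed.

Definition ftri : nat := ex_maxn ftri_ex ftri_bound.
End FTri.

Definition edge_extremal (d m : nat) (G : sgraph) : Prop :=
  [/\ Mtri d m G, #|edges G| = ftri d m & no_isolated G].

Definition star_components (d : nat) (G : sgraph) : nat :=
  #|[set S in components G | `[< isomorphic (induced S) (star d) >]]|.

Definition Gtri (d m : nat) (G : sgraph) : Prop :=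
  edge_extremal d m G /\
  forall H, edge_extremal d m H -> star_components d H <= star_components d G.

Definition critical_regular (d n : nat) (G : sgraph) : Prop :=
  [/\ triangle_free G, factor_critical G, matching_number G = n &
      if odd d then almost_regular G d else regular G d].

Section ZTri.
Variable d : nat.
Let admissible n : bool := (0 < n) && `[< exists G, critical_regular d n G >].
(* The value 0 is a dummy, used for d < 2 only: see ZtriP. *)
Definition Ztri : nat :=
  if pselect (exists n, admissible n) is left ex then ex_minn ex else 0.
End ZTri.

Section Partner.
Variables (N v : nat) (b : bool).

(* For v <= N and x != v, the partner of x in a perfect matching of circ minus v,
   where N = 4h. *)
Definition partner (x : nat) : nat :=
  if ~~ b then
    if x <= N then (if x < v then x + N.+1 else x + N)
    else if x <= N + v then x - N.+1 else x - N
  else if x <= N then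
    if x < v then (if odd v && (x == v.-1) then x + N.+2 else x + N.+1)
    else (if odd x then x + N.+1 else x + N.-1)
  else if x < N + v + ~~ odd v then x - N.+1
  else if odd v && (x == N + v + 1) then x - N.+2
  else (if odd x then x - N.-1 else x - N.+1).

Lemma partner_aux x y t : (t = N.-1 \/ t = N.+2) /\ b \/ t = N.+1 \/ t = N /\ ~~ b ->
  y = x + t \/ x = y + t -> y <= 2 * N -> y <> v -> partner x = y -> partner y = x ->
  [/\ partner x <= 2 * N, partner x <> v, partner (partner x) = x &
      exists2 t, (t = N.-1 \/ t = N.+2) /\ b \/ t = N.+1 \/ t = N /\ ~~ b &
        partner x = x + t \/ x = partner x + t].
Proof. by move=> ? ? ? ? -> ->; split => //; exists t. Qed.

Let if_eq (c : bool) (a d e : nat) :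
  (c -> a = e) -> (~~ c -> d = e) -> (if c then a else d) = e.
Proof. by case: c => h h'; [apply: h | apply: h']. Qed.

Ltac fin y t := apply: (@partner_aux _ y t);
  try lia; rewrite /partner; repeat (apply: if_eq => ?); lia.

Lemma partnerP x : 0 < N -> ~~ odd N -> v <= N -> x <= 2 * N -> x <> v ->
  [/\ partner x <= 2 * N, partner x <> v, partner (partner x) = x &
      exists2 t, (t = N.-1 \/ t = N.+2) /\ b \/ t = N.+1 \/ t = N /\ ~~ b &
        partner x = x + t \/ x = partner x + t].
Proof.
move=> N0 oN vN x2 xv; have [nb|bb] : ~~ b \/ b by lia.
  have [xN|Nx] := leqP x N.
    by have [ltxv|vx] := ltnP x v; [fin (x + N.+1) N.+1 | fin (x + N) N].
  by have [ltxv|vx] := leqP x (N + v); [fin (x - N.+1) N.+1 | fin (x - N) N].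
have [xN|Nx] := leqP x N.
  have [ltxv|vx] := ltnP x v.
    by have [/andP[ov /eqP xe]|ne] := boolP (odd v && (x == v.-1));
      [fin (x + N.+2) N.+2 | fin (x + N.+1) N.+1].
  by have [ox|ex] := boolP (odd x); [fin (x + N.+1) N.+1 | fin (x + N.-1) N.-1].
have [ltxv|vx] := ltnP x (N + v + ~~ odd v); first by fin (x - N.+1) N.+1.
have [/andP[ov /eqP xe]|ne] := boolP (odd v && (x == N + v + 1)).
  by fin (x - N.+2) N.+2.
by have [ox|ex] := boolP (odd x); [fin (x - N.-1) N.-1 | fin (x - N.+1) N.+1].
Qed.
End Partner.

Lemma invol_matching (G : sgraph) (S : {set G}) (g : G -> G) :
    (forall x, x \in S -> [/\ g x \in S, g (g x) = x & x -- g x]) ->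
  exists2 M : {set {set G}}, matching M & cover M = S.
Proof.
move=> gS; exists [set [set x; g x] | x in S].
  apply/andP; split.
    apply/subsetP => _ /imsetP[x /gS[_ _ xg] ->]; apply/edgeP.
    by exists x, (g x).
  have block x z : x \in S -> z \in [set x; g x] -> [set x; g x] = [set z; g z].
    by move=> /gS[_ ggx _] /set2P[]-> //; rewrite ggx setUC.
  apply/trivIsetP => _ _ /imsetP[x xS ->] /imsetP[y yS ->].
  apply: contraR => /pred0Pn[z /= /andP[zx zy]].
  by rewrite (block x z) // (block y z).
apply/setP => z; rewrite /cover; apply/bigcupP/idP.
  by case=> _ /imsetP[x xS ->] /set2P[]->; have [gx _ _] := gS _ xS.
by move=> zS; exists [set z; g z]; [apply/imsetP; exists z | apply: set21].
Qed.

Section Existence.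
Variables (h : nat) (b : bool).
Let N := 4 * h.

Let circ_adj : rel 'I_(2 * N).+1 := fun x y =>
  let t := (x - y) + (y - x) in
  [&& N + 1 - h <= t, t <= N + h & ~~ (b && (t == N))].
Fact circ_sym : symmetric circ_adj.
Proof. by move=> x y; rewrite /circ_adj (addnC (x - y)). Qed.
Fact circ_irr : irreflexive circ_adj.
Proof. by move=> x; rewrite /circ_adj /N; lia. Qed.
(* On Z/(8h+1): for b = false, the Cayley graph whose connection set consists of
   the 2h residues nearest to (8h+1)/2; for b = true, the same graph without the
   pairs of representatives in [0, 8h] at distance exactly 4h, which lowers the
   degree by 2 at 4h and by 1 elsewhere. *)
Definition circ : sgraph := SGraph circ_sym circ_irr.

Lemma circ_adjE (x y : circ) : (x -- y) = circ_adj x y. Proof. by []. Qed.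

Lemma circ_tf : triangle_free circ.
Proof.
move=> [x hx] [y hy] [z hz]; rewrite !circ_adjE /circ_adj /= /N => -[h1 h2 h3].
lia.
Qed.

Lemma card_itv n a c : c <= n -> #|[set y : 'I_n | a <= y < c]| = c - a.
Proof.
move=> cn; rewrite cardsE cardE size_filter -(count_map val [pred i | a <= i < c]).
rewrite -enumT val_enum_ord -size_filter.
have -> : [seq i <- iota 0 n | [pred i | a <= i < c] i] = iota a (c - a).
  apply: (irr_sorted_eq ltn_trans ltnn).
  - by rewrite sorted_filter ?iota_ltn_sorted //; apply: ltn_trans.
  - exact: iota_ltn_sorted.
  - by move=> i; rewrite mem_filter /= !mem_iota; lia.
by rewrite size_iota.
Qed.

Lemma circ_deg (x : circ) : 0 < h ->
  deg x = if b then (if x == N :> nat then 2 * h - 2 else 2 * h - 1) else 2 * h.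
Proof.
move=> h0; have ltx := ltn_ord x; set n := (2 * N).+1 in ltx.
pose I a c := [set y : 'I_n | a <= y < c].
pose up1 := I (x + N + 1 - h) (minn n (x + N)).
pose up2 := I (x + N + b) (minn n (x + N + h + 1)).
pose lo1 := I (x - N - h) (x - N).
pose lo2 := I (x + b - N) (x - (N - h)).
have disj (A B : {set 'I_n}) : (forall y, y \in A -> y \notin B) ->
    #|A :|: B| = #|A| + #|B|.
  move=> AB; rewrite cardsU (_ : A :&: B = set0) ?cards0 ?subn0 //.
  by apply/setP => y; rewrite !inE; apply/negP => /andP[/AB/negP].
have -> : deg x = #|up1 :|: up2 :|: lo1 :|: lo2|.
  congr #|pred_of_set _|; apply/setP => y; rewrite !inE circ_adjE /circ_adj.
  have := ltn_ord y; rewrite -/n; move: ltx; rewrite /n /N /=.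
  move: (nat_of_ord x) (nat_of_ord y) => {up1 up2 lo1 lo2 I disj}x' y'.
  have [xy|yx] := leqP x' y'.
    have -> : x' - y' = 0 by lia.
    by case: (b) => /= h1 h2; apply/idP/idP; lia.
  have -> : y' - x' = 0 by lia.
  by case: (b) => /= h1 h2; apply/idP/idP; lia.
rewrite !disj.
  rewrite !card_itv; move: ltx; rewrite /n /N; move: (nat_of_ord x) => x';
    rewrite /minn; case: (b) => /= ltx'; repeat (case: ltnP => ?);
    try (case: eqP => ?); lia.
all: move=> y; rewrite !inE; have := ltn_ord y; move: ltx; rewrite /n /N /=.
all: move: (nat_of_ord x) (nat_of_ord y) => x' y'; case: (b) => /=; lia.
Qed.


Let mate (v x : nat) : nat :=
  if v <= N then partner N v b x else 2 * N - partner N (2 * N - v) b (2 * N - x).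

Lemma mateP (v x : circ) : 0 < h -> (b -> 1 < h) -> x != v ->
  [/\ mate v x <= 2 * N, mate v x <> v, mate v (mate v x) = x &
     forall y : circ, y = mate v x :> nat -> x -- y].
Proof.
move=> h0 h1 /eqP xv'; have xv : x <> v :> nat by move=> /ord_inj.
have ltx := ltn_ord x; have ltv := ltn_ord v.
have N0 : 0 < N by rewrite /N; lia.
have oN : ~~ odd N by rewrite /N; lia.
rewrite {xv'}/mate; have [vN|Nv] := leqP v N.
  have [p1 p2 p3 [t ht et]] := @partnerP N v b x N0 oN vN ltx xv.
  split => // y ey; rewrite circ_adjE /circ_adj ey.
  have -> : (x - partner N v b x) + (partner N v b x - x) = t by lia.
  by move: ht h1; rewrite /N; case: (b) => /=; lia.
have v'N : 2 * N - v <= N by lia.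
have x'v' : 2 * N - x <> 2 * N - v by lia.
have [p1 p2 p3 [t ht et]] := @partnerP N _ b _ N0 oN v'N (leq_subr x (2 * N)) x'v'.
split; try lia.
  by rewrite subKn // p3; lia.
move=> y ey; rewrite circ_adjE /circ_adj ey.
move: (partner _ _ _ _) p1 et {p2 p3 ey} => z p1 et.
have -> : (x - (2 * N - z)) + ((2 * N - z) - x) = t by lia.
by move: ht h1; rewrite /N; case: (b) => /=; lia.
Qed.

Let circ_mate (v x : circ) : circ := inord (mate v x) : 'I_(2 * N).+1.

Lemma circ_mateP (v x : circ) : 0 < h -> (b -> 1 < h) -> x != v ->
  [/\ circ_mate v x != v, circ_mate v (circ_mate v x) = x & x -- circ_mate v x].
Proof.
move=> h0 h1 xv; have [p1 p2 p3 p4] := mateP h0 h1 xv.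
have E : circ_mate v x = mate v x :> nat by rewrite /circ_mate inordK.
split; last exact: p4.
- by apply/eqP => /(congr1 (@nat_of_ord _)); rewrite E.
- by apply: ord_inj; rewrite {1}/circ_mate E p3 inord_val.
Qed.

Lemma circ_fc : 0 < h -> (b -> 1 < h) -> factor_critical circ.
Proof.
move=> h0 h1 v; set H := induced _.
have nv (u : H) : val u != v by have := valP u; rewrite !inE.
pose g (u : H) : H := insubd u (circ_mate v (val u)).
have gE u : val (g u) = circ_mate v (val u).
  by have [gv _ _] := circ_mateP h0 h1 (nv u); rewrite /g val_insubd !inE gv.
have [u _|M mM cM] := @invol_matching H [set: H] g; last first.
  by exists M; rewrite /perfect_matching mM cM eqxx.
have [gv ggu ug] := circ_mateP h0 h1 (nv u).
split; rewrite ?inE //; first by apply: val_inj; rewrite !gE.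
by change (val u -- val (g u)); rewrite gE.
Qed.

Lemma circ_nu : 0 < h -> (b -> 1 < h) -> matching_number circ = N.
Proof.
move=> h0 h1; apply/eqP; rewrite eqn_leq; apply/andP; split.
  have [M mM <-] := matching_number_attained circ.
  have := subset_leq_card (subsetT (cover M)).
  by rewrite cardsT card_ord (card_cover_matching mM); lia.
pose v : circ := (ord0 : 'I_(2 * N).+1).
have [x|M mM cM] := @invol_matching circ [set~ v] (circ_mate v).
  by rewrite !inE => /(circ_mateP h0 h1).
have := leq_matching_number mM; have := card_cover_matching mM.
by rewrite cM cardsC1 card_ord /=; lia.
Qed.

End Existence.

Lemma critical_regular_ex (d : nat) :
  2 <= d -> exists2 n, 0 < n & exists G, critical_regular d n G.
Proof.
move=> d2; pose h := uphalf d.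
have h0 : 0 < h by rewrite /h; lia.
have h1 : odd d -> 1 < h by rewrite /h; lia.
exists (4 * h); first by lia.
exists (circ h (odd d)); split.
- exact: circ_tf.
- exact: circ_fc.
- exact: circ_nu.
set G := circ _ _; have D (x : G) := @circ_deg h (odd d) x h0.
case: ifP => od.
  exists (inord (4 * h) : 'I_(2 * (4 * h)).+1); split.
    by rewrite D od inordK ?eqxx /h; lia.
  move=> y /eqP yN; rewrite D od; case: eqP => [E|_]; last by rewrite /h; lia.
  by case: yN; apply: ord_inj; rewrite inordK ?E //; lia.
by move=> x; rewrite D od /h; lia.
Qed.

Lemma ZtriP (d : nat) : 2 <= d ->
  [/\ 0 < Ztri d, exists G, critical_regular d (Ztri d) G &
     forall n G, 0 < n -> critical_regular d n G -> Ztri d <= n].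
Proof.
move=> /critical_regular_ex[n n0 exG]; rewrite /Ztri.
case: pselect => [ex|[]]; last by exists n; rewrite n0; apply/asboolP.
case: ex_minnP => z /andP[z0 /asboolP exz] minz; split => // k G k0 hG.
by apply: minz; rewrite k0; apply/asboolP; exists G.
Qed.

(* Main.v *)
(* By the Gallai-Edmonds decomposition, a graph of matching number at most m splits
   into a vertex set U and factor-critical blocks B of size 2 n_B + 1 without edges
   between different blocks, with |U| + sum n_B <= m.  So the number of edges
   exceeds d m by at most the sum of the gains e(B) - d n_B.  The degree bound gives
   a gain at most floor(d/2), and a gain smaller than that if n_B < Z(d), by the
   definition of Z(d); triangle-freeness gives gain at most 0 if n_B < d (Mantel's
   argument) and at most 1 if n_B = d.  In particular Z(d) >= d.  In the cases
   considered either at most one block has n_B >= d, or Z(d) <= d + 1 and a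
   superadditive bound on the gains applies; r > d never occurs.  Removing s
   components K_{1,d} lowers m by s and the number of edges by d s, so the same bound
   applied to the rest limits s. *)
Require Import Defs.
From mathcomp Require Import all_boot.
From mathcomp Require Import boolp zify.

Set Implicit Arguments.
Unset Strict Implicit.
Unset Printing Implicit Defensive.

(** * Matchings inside a vertex set *)

Section LocalMatching.
Variable G : sgraph.
Implicit Types (A B S T U : {set G}) (f g : {ffun G -> G}) (u v x y : G).

(* A matching inside S is encoded as the involution exchanging matched vertices;
   unmatched vertices are its fixed points. *)
Definition lmatch S f : bool :=
  [forall x, (f (f x) == x) && ((f x == x) || [&& x \in S, f x \in S & x -- f x])].
Definition moved f : {set G} := [set x | f x != x].
(** Counted in matched vertices, so this is twice the matching number of the subgraph induced by
    [S]. *)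
Definition lnu S : nat := \max_(f | lmatch S f) #|moved f|.

Lemma lmatchP S f : reflect
  (involutive f /\ forall x, f x != x -> [/\ x \in S, f x \in S & x -- f x])
  (lmatch S f).
Proof.
apply: (iffP forallP) => [h|[fK h] x].
  split=> x; first by have /andP[/eqP] := h x.
  by have /andP[_ /orP[->//|/and3P[]]] := h x.
rewrite fK eqxx /=; have [//|/= fx] := boolP (f x == x).
by apply/and3P; exact: h.
Qed.

Lemma leq_lnu S f : lmatch S f -> #|moved f| <= lnu S.
Proof. exact: (@leq_bigmax_cond _ (lmatch S) (fun f : {ffun G -> G} => #|moved f|)). Qed.

Lemma lnu_attained S : exists2 f, lmatch S f & #|moved f| = lnu S.
Proof.
have [|f hf ef] := @eq_bigmax_cond _ (lmatch S) (fun f : {ffun G -> G} => #|moved f|).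
  apply/card_gt0P; exists [ffun x => x]; apply/lmatchP; split=> x.
    by rewrite !ffunE.
  by rewrite ffunE eqxx.
by exists f.
Qed.

Lemma lmatch_matching S f : lmatch S f ->
  exists2 M : {set {set G}}, matching M & cover M = moved f.
Proof.
move=> /lmatchP[fK h]; apply: (@invol_matching _ (moved f) f) => x; rewrite inE => fx.
by have [_ _ xf] := h x fx; split=> //; rewrite inE fK eq_sym.
Qed.

Lemma moved_even S f : lmatch S f -> ~~ odd #|moved f|.
Proof.
by move=> /lmatch_matching[M mM <-]; rewrite (card_cover_matching mM); lia.
Qed.

Lemma lnu_even S : ~~ odd (lnu S).
Proof. by have [f hf <-] := lnu_attained S; apply: moved_even hf. Qed.

Lemma lnu_matching_number S : lnu S <= 2 * matching_number G.
Proof.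
have [f hf <-] := lnu_attained S; have [M mM <-] := lmatch_matching hf.
by rewrite (card_cover_matching mM) mulnC leq_mul2l leq_matching_number.
Qed.

Lemma lmatchS A B f : A \subset B -> lmatch A f -> lmatch B f.
Proof.
move=> /subsetP sAB /lmatchP[fK h]; apply/lmatchP; split=> // x /h[xA fA xf].
by split; rewrite ?sAB.
Qed.

Definition switch A f g : {ffun G -> G} := [ffun x => if x \in A then g x else f x].

Lemma moved_switch A f g :
  #|moved (switch A f g)| = #|moved g :&: A| + #|moved f :\: A|.
Proof.
rewrite -(cardsID A); congr (_ + _).
  by apply: eq_card => x; rewrite !inE ffunE; case: (x \in A); rewrite ?andbF.
by apply: eq_card => x; rewrite !inE ffunE; case: (x \in A).
Qed.

Lemma switch_lmatch S A f g : lmatch S f -> lmatch S g ->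
    (forall x, x \in A -> g x \in A) -> (forall x, x \in A -> f x \in A) ->
  lmatch S (switch A f g).
Proof.
move=> /lmatchP[fK hf] /lmatchP[gK hg] gA fA; apply/lmatchP.
have fA' x : x \notin A -> f x \notin A by apply: contra => /fA; rewrite fK.
split=> x; rewrite !ffunE; have [xA|xA] := boolP (x \in A).
- by rewrite gA.
- by rewrite (negbTE (fA' _ xA)).
- exact: hg.
- exact: hf.
Qed.

Lemma lnu_disjoint A B : [disjoint A & B] -> lnu A + lnu B <= lnu (A :|: B).
Proof.
move=> dAB; have [f fA <-] := lnu_attained A; have [g gB <-] := lnu_attained B.
have [gK hg] := lmatchP _ _ gB; have [fK hf] := lmatchP _ _ fA.
have AB x : x \in A -> x \in B = false by move=> xA; apply: disjointFr dAB xA.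
have sm : lmatch (A :|: B) (switch B f g).
  apply: switch_lmatch.
  - exact: lmatchS (subsetUl _ _) fA.
  - exact: lmatchS (subsetUr _ _) gB.
  - by move=> x xB; have [->//|/hg[]] := eqVneq (g x) x.
  - by move=> x xB; have [->//|/hf[/AB]] := eqVneq (f x) x; rewrite xB.
apply: leq_trans (leq_lnu sm); rewrite moved_switch addnC.
apply: leq_add; apply: subset_leq_card; apply/subsetP => x; rewrite !inE => mx.
  by have [-> _ _] := hg x mx; rewrite mx.
by have [/AB-> _ _] := hf x mx; rewrite mx.
Qed.

Lemma lnu_adj S x y : x \in S -> y \in S -> x -- y -> 2 <= lnu S.
Proof.
move=> xS yS xy; have nxy : x != y by apply: contraTneq xy => ->; rewrite adj_irr.
pose f := [ffun z => if z == x then y else if z == y then x else z] : {ffun G -> G}.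
have fx : f x = y by rewrite ffunE eqxx.
have fy : f y = x by rewrite ffunE eq_sym (negbTE nxy) eqxx.
have fz z : z != x -> z != y -> f z = z.
  by move=> /negbTE zx /negbTE zy; rewrite ffunE zx zy.
suff fS : lmatch S f.
  apply: leq_trans (leq_lnu fS); have <- : #|[set x; y]| = 2 by rewrite cards2 nxy.
  apply: subset_leq_card; apply/subsetP => z /set2P[]->; rewrite inE ?fx ?fy //.
  by rewrite eq_sym.
apply/lmatchP; split=> z; have [->|zx] := eqVneq z x; rewrite ?fx ?fy //;
  have [->|zy] := eqVneq z y; rewrite ?fx ?fy ?(fz z) ?eqxx //.
by rewrite adj_sym.
Qed.

Definition maximum S f : bool := lmatch S f && (#|moved f| == lnu S).

(* The component of t in the union of two matchings f and g is the orbit of t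
   under g \o f when g misses t: it is a path ending at t, so f misses at most
   one of its vertices. *)
Lemma maximum_switch S f g t u v : maximum S f -> maximum S g ->
    g t = t -> f u = u -> f v = v -> u != v ->
  exists2 h, maximum S h & h t = t /\ (h u = u \/ h v = v).
Proof.
move=> /andP[mf /eqP cf] /andP[mg /eqP cg] gt fu fv nuv.
have [fK _] := lmatchP _ _ mf; have [gK _] := lmatchP _ _ mg.
pose p : G -> G := fun x => g (f x).
have pinj : injective p by move=> x y /(can_inj gK)/(can_inj fK).
(* Conjugation by [f] inverts [p], so from the [f]-image of a point of the path the iteration runs
   back to [t], where [g] stops it. *)
have back i : iter i.+1 p (f (iter i p t)) = t.
  elim: i => [|i IH]; first by rewrite /= /p fK.
  by rewrite iterSr [iter i.+1 p t]/= {2}/p {3}/p fK gK.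
pose Q := [set x | fconnect p t x].
have fQ x : x \in Q -> f x \in Q.
  rewrite !inE => /iter_findex <-; rewrite (fconnect_sym pinj).
  by have := fconnect_iter p (findex p t x).+1 (f (iter (findex p t x) p t)); rewrite back.
have gQ x : x \in Q -> g x \in Q.
  move=> xQ; have := fQ x xQ; rewrite !inE => h.
  by apply: connect_trans h _; have := fconnect1 p (f x); rewrite /p fK.
have per k : 0 < k < 2 * order p t -> iter k p t = t -> k = order p t.
  move=> /andP[k0 k2] kt; have small j : j < order p t -> iter j p t = t -> j = 0.
    by move=> /findex_iter E jt; rewrite -E jt findex0.
  have [kn|nk] := ltnP k (order p t); first by have := small k kn kt; lia.
  have E : iter (k - order p t) p t = t.
    by have := iterD (k - order p t) (order p t) p t; rewrite subnK // kt iter_order.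
  have := small (k - order p t) ltac:(lia) E; lia.
(* If [f] fixes the point j steps after [t], then 2j+1 steps return to [t]. So 2j+1 is the length of
   the orbit and j is determined: at most one of [u], [v] lies in [Q]. *)
have half x : x \in Q -> f x = x -> (findex p t x).*2.+1 = order p t.
  rewrite inE => tx fx; have lt := findex_max tx; apply: per; first by lia.
  rewrite -addnn -addSn iterD; have := back (findex p t x).
  by rewrite iter_findex // fx.
have [w wuv wQ] : exists2 w, w \in [:: u; v] & w \notin Q.
  have [uQ|uQ] := boolP (u \in Q); last by exists u; rewrite ?mem_head.
  exists v; first by rewrite !inE eqxx orbT.
  apply/negP => vQ; case/eqP: nuv.
  have E : findex p t u = findex p t v.
    by have := half u uQ fu; have := half v vQ fv; lia.
  by rewrite !inE in uQ vQ; rewrite -(iter_findex uQ) E iter_findex.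
have hw : switch Q f g w = w.
  by rewrite ffunE (negbTE wQ); move: wuv; rewrite !inE => /orP[]/eqP->.
exists (switch Q f g); last first.
  split; first by rewrite ffunE inE connect0.
  by move: wuv hw; rewrite !inE => /orP[]/eqP->; [left | right].
(* The two opposite switches along [Q] have total size [2 * lnu S], and neither exceeds [lnu S], so
   both are maximum. *)
have m1 := switch_lmatch mf mg gQ fQ; have m2 := switch_lmatch mg mf fQ gQ.
rewrite /maximum m1 /= eqn_leq (leq_lnu m1) /=.
have := leq_lnu m2; rewrite !moved_switch.
by have := cardsID Q (moved f); have := cardsID Q (moved g); lia.
Qed.

(** Factor-criticality of [induced B], phrased with involutions of the ambient graph to avoid
    subtypes. *)
Definition critical_block B : Prop :=
  forall v, v \in B -> exists2 f, lmatch B f & moved f = B :\ v.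

Definition separated (P : {set {set G}}) : Prop :=
  forall A B x y, A \in P -> B \in P -> x \in A -> y \in B -> x -- y -> A = B.

(** Gallai's lemma. The blocks are the classes of the relation [R] that no maximum matching misses
    two given distinct vertices together; transitivity comes from [maximum_switch]. A maximum
    matching missing [v] covers the rest of the class of [v], and it does so inside the class
    because adjacent vertices are related. *)
Lemma missable_decomposition T :
    (forall v, v \in T -> exists2 f, maximum T f & f v = v) ->
  exists P, [/\ partition P T, separated P, {in P, forall B, critical_block B} &
    \sum_(B in P) #|B|.-1 <= lnu T].
Proof.
move=> miss.
pose R u v := (u == v) || [forall f, maximum T f ==> ~~ ((f u == u) && (f v == v))].
have RP u v : R u v -> u != v -> forall f, maximum T f -> f u = u -> f v != v.
  move=> + /negbTE nuv; rewrite /R nuv /= => /forallP h f mf fu.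
  by have := h f; rewrite mf fu eqxx.
have RI u v : (forall f, maximum T f -> f u = u -> f v = v -> False) -> R u v.
  move=> h; apply/orP; right; apply/forallP => f; apply/implyP => mf.
  by apply/negP => /andP[/eqP fu /eqP fv]; apply: h fu fv.
have Rsym u v : R u v = R v u.
  rewrite /R eq_sym; congr orb; apply: eq_forallb => f.
  by rewrite (andbC (f u == u)).
have Rtrans u t v : t \in T -> R u t -> R t v -> R u v.
  move=> tT Rut Rtv; have [->//|nut] := eqVneq u t.
  have [<-//|ntv] := eqVneq t v; have [->|nuv] := eqVneq u v.
    by rewrite /R eqxx.
  apply: RI => f mf fu fv; have [g mg gt] := miss t tT.
  have [h mh [ht [hu|hv]]] := maximum_switch mf mg gt fu fv nuv.
    by have /eqP := RP _ _ Rut nut h mh hu.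
  by have /eqP := RP _ _ Rtv ntv h mh ht.
have eqR : {in T & &, equivalence_rel R}.
  move=> x y z xT yT zT; split; first by rewrite /R eqxx.
  by move=> Rxy; apply/idP/idP; [apply: Rtrans; rewrite // Rsym | apply: Rtrans].
have partP := equivalence_partitionP eqR; set P := equivalence_partition R T in partP.
have /and3P[/eqP covP tiP _] := partP.
have memB B x y : B \in P -> x \in B -> y \in T -> (y \in B) = R x y.
  move=> BP xB yT; rewrite -(def_pblock tiP BP xB).
  rewrite pblock_equivalence_partition //.
  by rewrite -covP; apply/bigcupP; exists B.
have BT B x : B \in P -> x \in B -> x \in T.
  by move=> BP xB; rewrite -covP; apply/bigcupP; exists B.
(* A maximum matching missing both ends of an edge could be enlarged by that edge. *)
have adjR x y : x \in T -> y \in T -> x -- y -> R x y.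
  move=> xT yT xy; apply: RI => f /andP[mf /eqP cf] fx fy.
  have nxy : x != y by apply: contraTneq xy => ->; rewrite adj_irr.
  have d : [disjoint [set x; y] & moved f].
    rewrite disjoint_subset; apply/subsetP => z /set2P[]->; rewrite !inE ?fx ?fy;
    by rewrite eqxx.
  have m1 : lmatch (moved f) f.
    have [fK h] := lmatchP _ _ mf; apply/lmatchP; split=> // z fz.
    by have [_ _ ->] := h z fz; rewrite !inE fz fK eq_sym.
  have := leq_trans (leq_add (lnu_adj (set21 x y) (set22 x y) xy) (leq_lnu m1))
            (lnu_disjoint d).
  have s : [set x; y] :|: moved f \subset T.
    apply/subsetP => z /setUP[/set2P[]->//|]; rewrite inE => fz.
    by have [_ h] := lmatchP _ _ mf; have [] := h z fz.
  have [g mg <-] := lnu_attained ([set x; y] :|: moved f).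
  by move=> /leq_trans/(_ (leq_lnu (lmatchS s mg))); rewrite cf add2n ltnNge leqnSn.
exists P; split=> //.
- move=> A B x y AP BP xA yB xy.
  have yA : y \in A by rewrite (memB A x) ?adjR ?(BT A x) ?(BT B y).
  by rewrite -(def_pblock tiP AP yA) (def_pblock tiP BP yB).
- move=> B BP v vB; have [f mf fv] := miss v (BT B v BP vB).
  have /andP[/lmatchP[fK hf] _] := mf.
  have fB x : x \in B -> f x \in B.
    move=> xB; have [->//|/hf[xT fT xf]] := eqVneq (f x) x.
    by rewrite (memB B x) ?adjR.
  have fB' x : x \notin B -> f x \notin B by apply: contra => /fB; rewrite fK.
  exists [ffun x => if x \in B then f x else x].
    apply/lmatchP; split=> x; rewrite !ffunE; have [xB|xB] := boolP (x \in B).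
    - by rewrite fB.
    - by rewrite (negbTE xB).
    - by move=> /hf[_ _ ->]; rewrite fB.
    - by rewrite eqxx.
  apply/setP => x; rewrite !inE ffunE; have [xB|xB] := boolP (x \in B); last first.
    by rewrite eqxx andbF.
  have [->|xv] := eqVneq x v; first by rewrite fv eqxx.
  have Rvx : R v x by rewrite -(memB B v) // (BT B x).
  by rewrite (RP v x Rvx _ f mf fv) // eq_sym.
(* A maximum matching misses at most one vertex of each class, which gives the inequality. *)
have [f mf cf] := lnu_attained T.
have maxf : maximum T f by rewrite /maximum mf cf eqxx.
have sub : moved f \subset T.
  by apply/subsetP => x; rewrite inE; have [_ h] := lmatchP _ _ mf => /h[].
rewrite -cf; have -> : #|moved f| = \sum_(B in P) #|moved f :&: B|.
  rewrite -sum1_card (eq_bigl (fun x => (x \in T) && (x \in moved f))); last first.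
    by move=> x; rewrite andbC; case: (boolP (x \in moved f)) => // /(subsetP sub).
  rewrite (set_partition_big_cond _ partP); apply: eq_bigr => B _.
  by rewrite -sum1_card; apply: eq_bigl => x; rewrite in_setI andbC.
apply: leq_sum => B BP; rewrite -(cardsID (moved f) B) (setIC B).
suff : #|B :\: moved f| <= 1 by lia.
apply/card_le1_eqP => x y; rewrite !inE !negbK => /andP[/eqP fx xB] /andP[/eqP fy yB].
apply: contraTeq isT; rewrite eq_sym => nxy; have Rxy : R x y by rewrite -(memB B x) ?(BT B y).
by have := RP x y Rxy nxy f maxf fx; rewrite fy eqxx.
Qed.

(* The Gallai-Edmonds form of the Tutte-Berge theorem, inside T. *)
Lemma critical_decomposition T : exists U (P : {set {set G}}),
  [/\ U \subset T, partition P (T :\: U), separated P,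
      {in P, forall B, critical_block B} &
      2 * #|U| + \sum_(B in P) #|B|.-1 <= lnu T].
Proof.
have [n] := ubnP #|T|; elim: n T => // n IH T leT.
(* A vertex covered by every maximum matching is moved to [U] and deleted; when none is left,
   Gallai's lemma applies. *)
have [/exists_inP[v vT /forallP all_v]|noex] :=
    boolP [exists v in T, [forall f, maximum T f ==> (f v != v)]]; last first.
  have [|P [partP sP cP leP]] := @missable_decomposition T.
    move=> v vT; suff /existsP[f /andP[mf /eqP fv]] :
      [exists f : {ffun G -> G}, maximum T f && (f v == v)] by exists f.
    move: noex; apply: contraR => /existsPn nv; apply/exists_inP; exists v => //.
    by apply/forallP => f; apply/implyP => mf; have := nv f; rewrite mf.
  by exists set0, P; rewrite sub0set setD0 cards0 muln0.
have [|U [P [sU partP sP cP leP]]] := IH (T :\ v).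
  by move: leT; rewrite (cardsD1 v T) vT.
exists (v |: U), P; split=> //.
- rewrite subUset sub1set vT /=; apply: subset_trans sU _; exact: subsetDl.
- by rewrite setDDl in partP.
have vU : v \notin U by apply/negP => /(subsetP sU); rewrite !inE eqxx.
have [f mf cf] := lnu_attained (T :\ v).
have fT := lmatchS (subsetDl T [set v]) mf.
(* Equality would make a matching that misses [v] maximum in [T]. Both values are even, so the drop
   is at least 2, which pays for [v] in [U]. *)
have : lnu (T :\ v) != lnu T.
  apply: contraTneq isT => E; have := all_v f; rewrite /maximum fT cf E eqxx /=.
  by have [_ h] := lmatchP _ _ mf => /h[]; rewrite !inE eqxx.
have := leq_lnu fT; rewrite cf cardsU1 vU.
by have := lnu_even T; have := lnu_even (T :\ v); lia.
Qed.

End LocalMatching.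

(** * Edges inside a vertex set *)

Section InnerEdges.
Variable G : sgraph.
Implicit Types (A B S T U : {set G}) (u v w x y : G).

Definition dg B x : nat := #|[set y in B | x -- y]|.
Definition inner B : nat := #|[set e in edges G | e \subset B]|.

Lemma dgT x : dg [set: G] x = deg x.
Proof. by apply: eq_card => y; rewrite !inE. Qed.

Lemma leq_dg A B x : A \subset B -> dg A x <= dg B x.
Proof.
move=> /subsetP sAB; apply: subset_leq_card; apply/subsetP => y.
by rewrite !inE => /andP[/sAB-> ->].
Qed.

Lemma dg_sum B x : dg B x = \sum_(y in B) (x -- y).
Proof. by rewrite /dg -sum1dep_card big_mkcondr. Qed.

Lemma dg_exchange A B : \sum_(x in A) dg B x = \sum_(y in B) dg A y.
Proof.
under eq_bigr do rewrite dg_sum.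
rewrite exchange_big; apply: eq_bigr => y _; rewrite dg_sum.
by apply: eq_bigr => x _; rewrite adj_sym.
Qed.

Lemma dgD A B x : A \subset B -> dg B x = dg A x + dg (B :\: A) x.
Proof.
move=> sAB; rewrite !dg_sum (big_setID A) /=; congr addn.
by apply: eq_bigl => y; rewrite (setIidPr sAB).
Qed.

Lemma handshake_inner B : \sum_(x in B) dg B x = 2 * inner B.
Proof.
pose Q := [set p : G * G | [&& p.1 \in B, p.2 \in B & p.1 -- p.2]].
have -> : \sum_(x in B) dg B x = \sum_(p in Q) 1.
  under eq_bigr do rewrite /dg -sum1_card.
  rewrite pair_big_dep; apply: eq_bigl => -[x y]; rewrite !inE /=.
  by case: (x \in B).
pose h (p : G * G) : {set G} := [set p.1; p.2].
rewrite (partition_big_imset h).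
have -> : h @: Q = [set e in edges G | e \subset B].
  apply/setP => e; apply/imsetP/idP => [[[x y]]|].
    rewrite !inE /= => /and3P[xB yB xy] ->; apply/andP; split.
      by apply/edgeP; exists x, y.
    by rewrite subUset !sub1set xB.
  rewrite inE => /andP[/edgeP[x [y [xy ->]]]].
  rewrite subUset !sub1set => /andP[xB yB].
  by exists (x, y); rewrite // inE /= xB yB.
rewrite (eq_bigr (fun=> 2)) ?sum_nat_const; first by rewrite mulnC.
move=> e; rewrite inE => /andP[/edgeP[x [y [xy ->]]]].
rewrite subUset !sub1set => /andP[xB yB].
have nxy : x != y by apply: contraTneq xy => ->; rewrite adj_irr.
rewrite sum1dep_card.
have -> : 2 = #|[set (x, y); (y, x)]|.
  by rewrite cards2 xpair_eqE (negbTE nxy).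
apply: eq_card => -[a b]; rewrite !inE /= !xpair_eqE.
apply/idP/idP => [/andP[/and3P[_ _ ab] /eqP E]|].
  have nab : a != b by apply: contraTneq ab => ->; rewrite adj_irr.
  have := set21 a b; have := set22 a b; rewrite -/(h (a, b)) E !inE.
  move=> /orP[]/eqP eb /orP[]/eqP ea; move: nab; rewrite ea eb ?eqxx ?orbT //.
case/orP => /andP[/eqP-> /eqP->]; rewrite ?xB ?yB ?xy ?eqxx //=.
by rewrite adj_sym xy /h /= setUC eqxx.
Qed.

Lemma handshake : \sum_(x : G) deg x = 2 * #|edges G|.
Proof.
rewrite (_ : #|edges G| = inner [set: G]).
  by rewrite -handshake_inner; apply: eq_big => [x|x _]; rewrite ?inE ?dgT.
by apply: eq_card => e; rewrite !inE subsetT andbT.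
Qed.

(** Every edge inside [B] has an end outside the independent set [A]. *)
Lemma inner_independent A B : A \subset B -> (forall x y, x \in A -> y \in A -> ~~ (x -- y)) ->
  inner B <= \sum_(v in B :\: A) dg B v.
Proof.
move=> sAB ind; rewrite -(leq_pmul2l (ltn0Sn 1)) -handshake_inner.
rewrite (big_setID A) /= (setIidPr sAB).
suff: \sum_(x in A) dg B x <= \sum_(v in B :\: A) dg B v by lia.
rewrite (eq_bigr (dg (B :\: A))); first rewrite dg_exchange.
  by apply: leq_sum => x _; exact: leq_dg.
move=> x xA; rewrite (dgD x sAB) /dg.
suff -> : [set y in A | x -- y] = set0 by rewrite cards0.
by apply/setP => y; rewrite !inE; apply/negP => /andP[yA]; apply/negP; exact: ind.
Qed.

Lemma inner_setD1 B w : w \in B -> inner B = inner (B :\ w) + dg B w.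
Proof.
move=> wB; apply/eqP; rewrite -(eqn_pmul2l (ltn0Sn 1)) mulnDr -!handshake_inner.
have sw : [set w] \subset B by rewrite sub1set.
have E x : dg B x = dg [set w] x + dg (B :\ w) x by exact: dgD.
rewrite (big_setD1 w) //= (eq_bigr (fun x => dg [set w] x + dg (B :\ w) x)) //.
rewrite big_split /= dg_exchange big_set1.
have : dg B w = dg (B :\ w) w.
  by rewrite E -[RHS]add0n; congr addn; rewrite dg_sum big_set1 adj_irr.
lia.
Qed.

(** At most [d] edges meet each vertex of [U], and by separation every other edge lies inside one
    block. *)
Lemma inner_decomposition d T U (P : {set {set G}}) : (forall x, deg x <= d) ->
    U \subset T -> partition P (T :\: U) -> separated P ->
  inner T <= d * #|U| + \sum_(B in P) inner B.
Proof.
move=> hd sU partP sepP.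
have le_dg A x : dg A x <= d.
  by apply: leq_trans (hd x); rewrite -dgT leq_dg ?subsetT.
have le_sum A : \sum_(x in U) dg A x <= d * #|U|.
  by rewrite mulnC -sum_nat_const; apply: leq_sum => x _.
rewrite -(leq_pmul2l (ltn0Sn 1)) -handshake_inner mulnDr.
rewrite (big_setID U) /= (setIidPr sU).
have -> : 2 * \sum_(B in P) inner B = \sum_(x in T :\: U) dg (T :\: U) x.
  rewrite (set_partition_big _ partP) big_distrr /=; apply: eq_bigr => B BP.
  rewrite -handshake_inner; apply: eq_bigr => x xB; apply: eq_card => y.
  rewrite !inE; have [xy|] := boolP (x -- y); last by rewrite !andbF.
  rewrite !andbT -in_setD -(cover_partition partP).
  apply/idP/bigcupP => [yB|[A AP yA]]; first by exists B.
  by rewrite (sepP _ _ _ _ BP AP xB yA xy).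
have -> : \sum_(x in T :\: U) dg T x =
    \sum_(x in U) dg (T :\: U) x + \sum_(x in T :\: U) dg (T :\: U) x.
  by rewrite (eq_bigr _ (fun x _ => dgD x sU)) big_split /= dg_exchange.
by have := le_sum T; have := le_sum (T :\: U); lia.
Qed.

End InnerEdges.

Lemma sum_nat_gt_ex (T : finType) (A : {set T}) (F : T -> nat) c :
  #|A| * c < \sum_(x in A) F x -> exists2 x, x \in A & c < F x.
Proof.
move=> lt; apply/exists_inP; apply: contraLR lt => /exists_inPn h.
rewrite -leqNgt -sum_nat_const; apply: leq_sum => x xA.
by rewrite leqNgt; apply: h.
Qed.

(** * Edge bounds for vertex sets of odd order *)

Section BlockBounds.
Variables (G : sgraph) (d : nat).
Hypothesis tf : triangle_free G.
Hypothesis hd : forall x : G, deg x <= d.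
Implicit Types (A B S T U : {set G}) (u v w x y : G).

Lemma dg_le B x : dg B x <= d.
Proof. by apply: leq_trans (hd x); rewrite -dgT leq_dg ?subsetT. Qed.

Lemma nbr_independent B x u v :
  u \in [set y in B | x -- y] -> v \in [set y in B | x -- y] -> ~~ (u -- v).
Proof.
rewrite !inE => /andP[_ xu] /andP[_ xv]; apply/negP => uv.
exact: (tf (And3 xu uv xv)).
Qed.

Lemma inner_le_regular B n : #|B| = 2 * n + 1 -> inner B <= d * n + d./2.
Proof.
move=> cB; have : \sum_(x in B) dg B x <= #|B| * d.
  by rewrite -sum_nat_const; apply: leq_sum => x _; apply: dg_le.
rewrite handshake_inner cB; move: (inner B) => e; nia.
Qed.

(** Mantel's argument: the neighbourhood of a vertex of largest degree D in [B] is independent, so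
    the other 2n+1-D vertices, of degree at most D, meet all edges. The product D(2n+1-D) is largest
    at D = n and D = n+1. *)
Lemma inner_mantel B n : #|B| = 2 * n + 1 -> inner B <= n * n.+1.
Proof.
move=> cB; have [x0 x0B] : exists x, x \in B by apply/card_gt0P; rewrite cB addn1.
have [x xB xmax] := arg_maxnP (dg B) x0B.
pose A := [set y in B | x -- y].
have sAB : A \subset B by apply/subsetP => y; rewrite inE => /andP[].
have := inner_independent sAB (@nbr_independent B x).
have cA : #|A| = dg B x by [].
have : \sum_(v in B :\: A) dg B v <= #|B :\: A| * dg B x.
  rewrite -sum_nat_const; apply: leq_sum => v; rewrite inE => /andP[_ vB].
  exact: xmax.
rewrite cardsD (setIidPr sAB) cA cB; move: (inner B) (dg B x) => e D.
suff: (2 * n + 1 - D) * D <= n * n.+1 by lia.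
have [Dn|nD] := leqP D n.
  rewrite (_ : 2 * n + 1 - D = n.+1 + (n - D)); last by lia.
  by rewrite -{2 3}(subnKC Dn); move: (n - D) => j; nia.
have [j ->] : exists j, D = n.+1 + j by exists (D - n.+1); lia.
have [jn|nj] := leqP j n; last by rewrite (_ : _ - _ = 0); lia.
rewrite (_ : 2 * n + 1 - _ = n - j); last by lia.
have [i ->] : exists i, n = j + i by exists (n - j); lia.
by rewrite addKn; nia.
Qed.

Lemma inner_lt_degree B n : #|B| = 2 * n + 1 -> n < d -> inner B <= d * n.
Proof. by move=> /inner_mantel; nia. Qed.

(* If e > d^2 + 1, the total degree deficiency is so small that two adjacent
   vertices x, y have degree d; their neighbourhoods A, C are independent and
   miss a single vertex w, whose neighbourhoods in A and C span no edge. *)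
Lemma inner_eq_degree B : #|B| = 2 * d + 1 -> inner B <= d * d + 1.
Proof.
move=> cB; rewrite leqNgt; apply/negP => gt.
have hB := handshake_inner B.
have [x xB dx] : exists2 x, x \in B & d.-1 < dg B x.
  by apply: sum_nat_gt_ex; rewrite hB cB; nia.
have {}dx : dg B x = d by have := dg_le B x; lia.
pose A := [set y in B | x -- y].
have cA : #|A| = d by [].
have sAB : A \subset B by apply/subsetP => y; rewrite inE => /andP[].
(* The d+1 vertices outside [A] account for at most d(d+1) of the degree sum, which is at least
   2(d^2+2); more than d(d-1) remains for [A]. *)
have [y yA dy] : exists2 y, y \in A & d.-1 < dg B y.
  apply: sum_nat_gt_ex; rewrite cA.
  have : \sum_(v in B :\: A) dg B v <= #|B :\: A| * d.
    by rewrite -sum_nat_const; apply: leq_sum => v _; apply: dg_le.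
  move: hB; rewrite (big_setID A) /= (setIidPr sAB) cardsD (setIidPr sAB) cA cB.
  by move: (\sum_(_ in _) _) (\sum_(_ in _) _) => a b; nia.
have {}dy : dg B y = d by have := dg_le B y; lia.
pose C := [set z in B | y -- z].
have cC : #|C| = d by [].
have sCB : C \subset B by apply/subsetP => z; rewrite inE => /andP[].
have xy : x -- y by move: yA; rewrite inE => /andP[].
have AC z : z \in A -> z \in C -> False.
  by rewrite !inE => /andP[_ xz] /andP[_ yz]; apply: (tf (And3 xy yz xz)).
have dAC : A :&: C = set0.
  by apply/setP => z; rewrite !inE; apply/negP => /andP[zA zC]; apply: (AC z); rewrite inE.
have cW : #|B :\: (A :|: C)| = 1.
  rewrite cardsD (setIidPr _) ?subUset ?sAB // cardsU dAC cards0 cA cC cB; lia.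
have /cards1P[w defW] : #|B :\: (A :|: C)| == 1 by rewrite cW.
have : w \in B :\: (A :|: C) by rewrite defW inE.
rewrite inE in_setU negb_or => /andP[/andP[wA wC] wB].
have memB z : z \in B -> [|| z \in A, z \in C | z == w].
  move=> zB; have [//|zA] := boolP (z \in A); have [//|zC] := boolP (z \in C).
  by have := in_set1 z w; rewrite -defW in_setD in_setU (negbTE zA) (negbTE zC) zB.
have indA := @nbr_independent B x; have indC := @nbr_independent B y.
pose Aw := [set z in A | w -- z]; pose Cw := [set z in C | w -- z].
(* If [w] has no neighbour in one of the sets [A], [C], adding [w] keeps that set independent; then
   the other set, of size d, meets all edges, and there are at most d^2 of them. *)
have star_bound (D E : {set G}) : #|E| = d -> D \subset B ->
    (forall u v, u \in D -> v \in D -> ~~ (u -- v)) ->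
    (forall z, z \in B -> [|| z \in D, z \in E | z == w]) ->
    w \notin D -> (forall z, z \in D -> ~~ (w -- z)) -> False.
  move=> cE sDB ind cov wD nw.
  have sub : w |: D \subset B by rewrite subUset sub1set wB.
  have : inner B <= \sum_(v in B :\: (w |: D)) dg B v.
    apply: inner_independent => // u v; rewrite !inE.
    case/orP => [/eqP->|uD] /orP[/eqP->|vD].
    - by rewrite adj_irr.
    - exact: nw.
    - by rewrite adj_sym; apply: nw.
    - exact: ind.
  have : \sum_(v in B :\: (w |: D)) dg B v <= #|E| * d.
    apply: (@leq_trans (\sum_(v in B :\: (w |: D)) d)).
      by apply: leq_sum => v _; apply: dg_le.
    rewrite sum_nat_const leq_mul2r subset_leq_card ?orbT //.
    apply/subsetP => z; rewrite !inE negb_or => /andP[/andP[/negbTE zw /negbTE zD] zB].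
    by have := cov z zB; rewrite zw zD orbF.
  by rewrite cE => h1 h2; move: gt (leq_trans h2 h1); clear; lia.
have [Aw0|Aw0] := eqVneq #|Aw| 0.
  apply: (star_bound A C) => // z zA; apply/negP => wz.
  by move/eqP: Aw0; rewrite cards_eq0 => /eqP/setP/(_ z); rewrite in_set0 inE zA wz.
have [Cw0|Cw0] := eqVneq #|Cw| 0.
  apply: (star_bound C A) => // [z|z zC]; first by move=> /memB; case: (z \in A); rewrite ?orbT.
  apply/negP => wz.
  by move/eqP: Cw0; rewrite cards_eq0 => /eqP/setP/(_ z); rewrite in_set0 inE zC wz.
pose B' := B :\ w.
have sCB' : C \subset B' by rewrite subsetD1 sCB.
have B'C : B' :\: C = A.
  apply/setP => z; rewrite in_setD in_setD1; apply/idP/idP => [/and3P[/negbTE zC /negbTE zw zB]|zA].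
    by have := memB z zB; rewrite zC zw !orbF.
  rewrite (subsetP sAB) // andbT; apply/andP; split; first by apply/negP => zC; apply: (AC z).
  by apply: contraNneq wA => <-.
have := inner_independent sCB' indC; rewrite B'C.
(* A neighbour [v] of [w] in [A] is adjacent to no neighbour of [w] in [C], as this would close a
   triangle. *)
have dA v : v \in A -> dg B' v <= #|C| - (v \in Aw) * #|Cw|.
  move=> vA; have NC : [set z in B' | v -- z] \subset C :\: (if v \in Aw then Cw else set0).
    apply/subsetP => z; rewrite inE => /andP[]; rewrite in_setD1 => /andP[zw zB] vz.
    have zC : z \in C.
      have := memB z zB; rewrite (negbTE zw) orbF => /orP[zA|//].
      by have := indA v z vA zA; rewrite vz.
    rewrite in_setD zC andbT; case: ifP; rewrite !inE // => /andP[_ wv].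
    apply/negP => /andP[_ wz]; exact: (tf (And3 wv vz wz)).
  apply: leq_trans (subset_leq_card NC) _; case: ifP => _.
    rewrite cardsD (setIidPr _) ?mul1n //.
    by apply/subsetP => z; rewrite inE => /andP[].
  by rewrite setD0 mul0n subn0.
have cCw : #|Cw| <= d.
  by rewrite -cC; apply: subset_leq_card; apply/subsetP => z; rewrite inE => /andP[].
have sAw : Aw \subset A by apply/subsetP => z; rewrite inE => /andP[].
have cAw : #|Aw| <= d by rewrite -cA; apply: subset_leq_card.
have : \sum_(v in A) dg B' v <= #|Aw| * (d - #|Cw|) + (d - #|Aw|) * d.
  rewrite (big_setID Aw) /= (setIidPr sAw); apply: leq_add.
    rewrite -sum_nat_const; apply: leq_sum => v vAw.
    by have := dA v (subsetP sAw v vAw); rewrite vAw cC mul1n.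
  have <- : #|A :\: Aw| = d - #|Aw| by rewrite cardsD (setIidPr sAw) cA.
  by rewrite -sum_nat_const; apply: leq_sum => v _; apply: dg_le.
have dw : dg B w <= #|Aw| + #|Cw|.
  apply: leq_trans (leq_card_setU Aw Cw); apply: subset_leq_card.
  apply/subsetP => z; rewrite inE => /andP[zB wz]; have := memB z zB.
  rewrite !inE wz !andbT; case/or3P=> [->|->|/eqP zw]; rewrite ?orbT //.
  by rewrite zw adj_irr in wz.
(* With a and c the numbers of neighbours of [w] in [A] and [C], there are at most d^2 - ac + a + c
   = d^2 + 1 - (a-1)(c-1) edges, and a, c are positive. *)
have := inner_setD1 wB; rewrite -/B'.
move: gt dw cAw cCw Aw0 Cw0; move: (inner B) (inner B') (dg B w) #|Aw| #|Cw| => e e' g a c.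
move: (\sum_(_ in _) _) => s; clear => *; nia.
Qed.

End BlockBounds.

(** * Critical blocks *)

Lemma matching_number_half (G : sgraph) n :
  #|G| <= 2 * n + 1 -> matching_number G <= n.
Proof.
move=> cG; have [M mM <-] := matching_number_attained G.
have := subset_leq_card (subsetT (cover M)).
by rewrite cardsT (card_cover_matching mM); lia.
Qed.

(** Common entry point for abstract blocks and for explicit tables, both of which supply
    near-perfect matchings as involutions. *)
Lemma mates_critical (H : sgraph) n : #|H| = 2 * n + 1 ->
    (forall v : H, exists g : H -> H, forall x, x != v ->
       [/\ g x != v, g (g x) = x & x -- g x]) ->
  factor_critical H /\ matching_number H = n.
Proof.
move=> cH mates; split=> [v|].
  have [g hg] := mates v; set K := induced _.
  have nv (u : K) : val u != v by have := valP u; rewrite !inE.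
  pose g' (u : K) : K := insubd u (g (val u)).
  have gE u : val (g' u) = g (val u).
    by have [gv _ _] := hg _ (nv u); rewrite /g' val_insubd !inE gv.
  have [u _|M mM cM] := @invol_matching K [set: K] g'; last first.
    by exists M; rewrite /perfect_matching mM cM eqxx.
  have [gv ggu ug] := hg _ (nv u).
  split; rewrite ?inE //; first by apply: val_inj; rewrite !gE.
  by change (val u -- val (g' u)); rewrite gE.
apply/eqP; rewrite eqn_leq matching_number_half ?cH //=.
have /card_gt0P[v _] : 0 < #|H| by lia.
have [g hg] := mates v.
have [x|M mM cM] := @invol_matching H [set~ v] g.
  by rewrite !inE => /hg.
have := leq_matching_number mM; have := card_cover_matching mM.
by rewrite cM cardsC1 cH; lia.
Qed.

Lemma card_induced (G : sgraph) (B : {set G}) : #|induced B| = #|B|.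
Proof. by rewrite card_sig; apply: eq_card => x. Qed.

Lemma deg_induced (G : sgraph) (B : {set G}) (u : induced B) : deg u = dg B (val u).
Proof.
rewrite /deg -(card_imset _ val_inj); apply: eq_card => y; rewrite inE.
apply/imsetP/andP => [[w]|[yB uy]]; first by rewrite inE => uw ->; split; first exact: valP.
by exists (Sub y yB); rewrite ?inE.
Qed.

Lemma critical_block_odd (G : sgraph) (B : {set G}) :
  critical_block B -> B != set0 -> #|B| = 2 * #|B|.-1./2 + 1.
Proof.
move=> cB /set0Pn[v vB]; have [f mf E] := cB v vB.
by have := moved_even mf; rewrite E (cardsD1 v B) vB; lia.
Qed.

Lemma critical_block_induced (G : sgraph) (B : {set G}) n :
    #|B| = 2 * n + 1 -> critical_block B ->
  factor_critical (induced B) /\ matching_number (induced B) = n.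
Proof.
move=> cB critB; apply: mates_critical; first by rewrite card_induced.
move=> v; have [f /lmatchP[fK hf] mf] := critB (val v) (valP v).
have mem x : (f x != x) = (x \in B :\ val v) by rewrite -mf inE.
have fv : f (val v) = val v by apply/eqP; rewrite -[_ == _]negbK mem !inE eqxx.
exists (fun u => insubd u (f (val u))) => x xv.
have fx : f (val x) != val x by rewrite mem !inE (valP x) andbT.
have [_ fB adj] := hf _ fx.
have gE (u : induced B) : f (val u) \in B -> val (insubd u (f (val u)) : induced B) = f (val u).
  by move=> h; rewrite val_insubd h.
split.
- apply: contraNneq xv => E; apply/eqP/val_inj.
  by rewrite -[val x]fK -(gE x fB) E.
- by apply: val_inj; rewrite gE gE // fK; exact: valP.
- by change (val x -- val (insubd x (f (val x)) : induced B)); rewrite gE.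
Qed.

(** Equality in the degree count makes the induced graph regular or almost regular, hence a
    competitor in the minimum defining Z(d). *)
Lemma Ztri_le_block (G : sgraph) (d n : nat) (B : {set G}) : 2 <= d ->
    triangle_free G -> (forall x : G, deg x <= d) ->
    #|B| = 2 * n + 1 -> critical_block B -> inner B = d * n + d./2 ->
  Ztri d <= n.
Proof.
move=> d2 tf hd cB critB eB; have [_ _ minZ] := ZtriP d2.
have [fc nu] := critical_block_induced cB critB.
have n0 : 0 < n.
  rewrite lt0n; apply/eqP => n0; have := inner_mantel tf cB; rewrite eB n0; lia.
apply: (minZ n (induced B)) => //; split=> //.
  by move=> x y z; exact: (@tf (val x) (val y) (val z)).
(* The total deficiency is (2n+1)d - 2(dn + floor(d/2)), which is the parity of d; if it is 1, a
   single vertex carries it. *)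
have def : \sum_(x in B) (d - dg B x) = odd d.
  have E : \sum_(x in B) ((d - dg B x) + dg B x) = #|B| * d.
    rewrite -sum_nat_const; apply: eq_bigr => x _.
    by rewrite subnK //; apply: dg_le.
  by move: E; rewrite big_split /= handshake_inner eB cB; move: (\sum_(_ in _) _) => s; nia.
have tight x : x \in B -> d - dg B x = 0 -> dg B x = d.
  by have := dg_le hd B x; lia.
case: ifP def => od def; last first.
  move=> u; rewrite deg_induced tight ?(valP u) //; apply/eqP.
  by move/eqP: def; rewrite sum_nat_eq0 => /forall_inP; apply; exact: valP.
have [x xB dx] : exists2 x, x \in B & 0 < d - dg B x.
  by apply: sum_nat_gt_ex; rewrite def muln0.
move: def; rewrite (big_setD1 x) //= => def.
have rest : \sum_(y in B :\ x) (d - dg B y) = 0 by lia.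
exists (Sub x xB); split; first by rewrite deg_induced /=; lia.
move=> u ux; rewrite deg_induced tight ?(valP u) //; apply/eqP.
move/eqP: rest; rewrite sum_nat_eq0 => /forall_inP; apply.
by rewrite !inE (valP u) andbT.
Qed.

(** The truncation at 0 is harmless, since [inner B] still is at most [d] times the half-size plus
    the gain. *)
Definition gain (d : nat) (G : sgraph) (B : {set G}) : nat := inner B - d * #|B|.-1./2.

Lemma block_gain (G : sgraph) (d n : nat) (B : {set G}) : 2 <= d ->
    triangle_free G -> (forall x : G, deg x <= d) ->
    critical_block B -> B != set0 -> n = #|B|.-1./2 ->
  [/\ gain d B <= d./2, n < d -> gain d B = 0, n = d -> gain d B <= 1 &
      n < Ztri d -> gain d B < d./2].
Proof.
move=> d2 tf hd critB B0 en; have cB := critical_block_odd critB B0.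
rewrite -en in cB; have le := inner_le_regular hd cB.
rewrite /gain -en; split; first by lia.
- by move=> /(inner_lt_degree tf cB); lia.
- by move=> E; rewrite E in cB *; have := inner_eq_degree tf hd cB; lia.
move=> nZ; rewrite ltnNge; apply/negP => ge.
suff : Ztri d <= n by rewrite leqNgt nZ.
by apply: (Ztri_le_block d2 tf hd cB critB); lia.
Qed.

(** The numerical content of the decomposition: [c] is the size of [U] and [n B] is half of |B|-1.
    What follows about gains uses only these numbers. *)
Lemma edge_gain (G : sgraph) (d : nat) (T : {set G}) : 2 <= d ->
    triangle_free G -> (forall x : G, deg x <= d) ->
  exists P : {set {set G}}, exists n : {set G} -> nat, exists c : nat,
    [/\ inner T <= d * (c + \sum_(B in P) n B) + \sum_(B in P) gain d B,
        2 * (c + \sum_(B in P) n B) <= lnu T &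
        {in P, forall B, [/\ gain d B <= d./2, n B < d -> gain d B = 0,
           n B = d -> gain d B <= 1 & n B < Ztri d -> gain d B < d./2]}].
Proof.
move=> d2 tf hd; have [U [P [sU partP sepP critP leP]]] := critical_decomposition T.
exists P, (fun B : {set G} => #|B|.-1./2), #|U|.
have nz B : B \in P -> B != set0.
  by have /and3P[_ _ n0] := partP; apply: contraTneq => ->.
split.
- apply: leq_trans (inner_decomposition hd sU partP sepP) _.
  rewrite mulnDr -addnA leq_add2l big_distrr -big_split /=; apply: leq_sum => B BP.
  by rewrite /gain; lia.
- apply: leq_trans leP; rewrite mulnDr leq_add2l big_distrr /=; apply: leq_sum => B BP.
  lia.
by move=> B BP; apply: block_gain => //; [apply: critP | apply: nz].
Qed.

(** * Sums of gains *)

(** The gain reachable with total size [x]: as many blocks of size [Z] as fit, each gaining [h], and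
    one more if the remainder admits a block of size [d]. *)
Definition cap (d Z h x : nat) : nat := x %/ Z * h + (d <= x %% Z).

Lemma capE d Z h q x : x < Z -> cap d Z h (q * Z + x) = q * h + (d <= x).
Proof.
move=> xZ; have Z0 : 0 < Z by lia.
by rewrite /cap divnMDl // divn_small // addn0 modnMDl modn_small.
Qed.

Section Superadditive.
Variables d Z h : nat.
Hypotheses (h0 : 0 < h) (d0 : 0 < d) (dZ : d <= Z) (Zd : Z = d \/ Z = d.+1 /\ 2 <= h).

(** If the remainders add up without a carry, at most one of them reaches [d]. With a carry, [h] is
    gained while up to two units are lost; if Z = d no remainder reaches [d], and if Z = d+1 then h
    is at least 2. *)
Lemma cap_superadditive x y : cap d Z h x + cap d Z h y <= cap d Z h (x + y).
Proof.
have Z0 : 0 < Z by lia.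
rewrite /cap divnD // modnD //.
have := ltn_pmod x Z0; have := ltn_pmod y Z0.
move: (x %/ Z) (y %/ Z) (x %% Z) (y %% Z) => p q a b bZ aZ.
rewrite !mulnDl; case: (leqP Z (a + b)) => ab; rewrite ?mul1n ?mul0n ?subn0.
  by case: (leqP d a); case: (leqP d b); case: (leqP d _); case: Zd; lia.
by case: (leqP d a); case: (leqP d b); case: (leqP d _); case: Zd; lia.
Qed.

Lemma leq_cap x y : x <= y -> cap d Z h x <= cap d Z h y.
Proof. by move=> /subnKC <-; have := cap_superadditive x (y - x); lia. Qed.

End Superadditive.

Section GainSum.
Variables (I : finType) (A : {set I}) (n g : I -> nat) (d Z h k r m s c : nat).
Hypothesis block : {in A, forall i, [/\ g i <= h, n i < d -> g i = 0,
  n i = d -> g i <= 1 & n i < Z -> g i < h]}.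
Hypotheses (d0 : 0 < d) (h0 : 0 < h) (dZ : d <= Z) (em : m = k * Z + r) (rZ : r < Z).
Hypothesis total : c + \sum_(i in A) n i + s <= m.

(** Two blocks of size at least [d] would exceed the total, and smaller blocks gain nothing. *)
Lemma gain_sum_single : \sum_(i in A) n i < 2 * d -> \sum_(i in A) g i = 0 \/
  exists i, [/\ i \in A, \sum_(j in A) g j = g i, d <= n i & n i <= \sum_(j in A) n j].
Proof.
move=> lt2; have [/exists_inP[i iA di]|no] := boolP [exists i in A, d <= n i]; last first.
  left; apply/eqP; rewrite sum_nat_eq0; apply/forall_inP => i iA.
  have [_ -> //] := block iA; rewrite ltnNge; apply: contra no => di.
  by apply/exists_inP; exists i.
right; exists i; move: lt2; rewrite (big_setD1 i) //= => lt2; split=> //; last first.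
  exact: leq_addr.
rewrite (big_setD1 i) //= -[RHS]addn0; congr addn; apply/eqP.
rewrite sum_nat_eq0; apply/forall_inP => j /setD1P[ji jA].
have [_ -> //] := block jA; move: lt2; rewrite (big_setD1 j) ?inE ?ji //=; lia.
Qed.

Lemma gain_sum_cap : Z = d \/ Z = d.+1 /\ 2 <= h ->
  \sum_(i in A) g i <= cap d Z h (\sum_(i in A) n i).
Proof.
move=> Zd; elim/big_rec2: _ => // i a b iA IH.
apply: leq_trans (cap_superadditive h0 d0 dZ Zd _ _); apply: leq_add => //.
have [gh g0 g1 gZ] := block iA; have [nd|dn] := ltnP (n i) d; first by rewrite g0.
(* A block of size at least [Z] is paid for by one full [h]; one of size between [d] and Z-1 exists
   only for Z = d+1 and has size [d]. *)
have [nZ|Zn] := ltnP (n i) Z; last first.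
  rewrite /cap (leq_trans gh) // (leq_trans _ (leq_addr _ _)) //.
  by rewrite leq_pmull // divn_gt0 //; lia.
rewrite -[n i]add0n -(mul0n Z) capE // mul0n dn g1 //; case: Zd; lia.
Qed.

(** The [s] units spent on stars are lost to the blocks, which keep at most m-s. Too many stars
    therefore push the attainable gain strictly below its maximum. *)
Lemma gain_sum_bound :
    m <= d \/ (Z = d \/ Z = d.+1 /\ 2 <= h) \/ Z <= m < 2 * d ->
  \sum_(i in A) g i <= k * h + (d <= r) /\
  (k * h + (d <= r) <= \sum_(i in A) g i -> s <= (if r < d then r else 0)).
Proof.
have small : m < 2 * d -> k * Z <= m /\ k <= 1.
  by move=> lt; split; [lia | nia].
case=> [md|[Zd|/andP[Zm m2]]].
- have lt2 : \sum_(i in A) n i < 2 * d by lia.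
  have [_ k1] := small ltac:(lia).
  have [->|[i [iA -> dn nn]]] := gain_sum_single lt2.
    by split=> //; case: (ltnP r d) => rd; move: k1 em; case: (k) => [|[]] //=; lia.
  have [gh g0 g1 gZ] := block iA; have := g1 ltac:(lia).
  case: (ltnP r d) => rd; move: k1 em; case: (k) => [|[]] //=; lia.
- have le := gain_sum_cap Zd.
  have le2 : cap d Z h (\sum_(i in A) n i) <= cap d Z h (m - s).
    by apply: leq_cap => //; lia.
  have eV : cap d Z h m = k * h + (d <= r) by rewrite em capE.
  split; first by rewrite -eV (leq_trans le) // leq_cap //; lia.
  move=> ge; rewrite leqNgt; apply/negP => lts.
  (* The largest sizes at which [cap] is still smaller: if r >= d, one unit less loses the extra 1;
     if r < d, going below kZ loses a full block, and the remainder Z-1 returns less than [h]. *)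
  have [x ltx lex] : exists2 x, cap d Z h x < k * h + (d <= r) & m - s <= x.
    move: lts; case: (ltnP r d) => rd lts; last first.
      exists (k * Z + r.-1); last by lia.
      rewrite capE; last by lia.
      by rewrite ltn_add2l; move: Zd; lia.
    have k0 : 0 < k by rewrite lt0n; apply/eqP => k0; move: em; rewrite k0; lia.
    have ek : k * h = k.-1 * h + h by rewrite -mulSnr prednK.
    have ekZ : k * Z = k.-1 * Z + Z by rewrite -mulSnr prednK.
    exists (k.-1 * Z + Z.-1); last by lia.
    rewrite capE; last by lia.
    by move: Zd; lia.
  have := leq_cap h0 d0 dZ Zd lex; lia.
have lt2 : \sum_(i in A) n i < 2 * d by lia.
have [_ k1] := small m2.
(* From d <= Z <= m < 2d it follows that k = 1 and r = m - Z < d. *)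
have {k1} ek : k = 1 by move: k1 em; case: (k) => [|[]] //=; lia.
have rd : r < d by move: em; rewrite ek; lia.
rewrite rd ek mul1n (leqNgt d r) rd addn0.
have [->|[i [iA -> dn nn]]] := gain_sum_single lt2; first by split; lia.
have [gh g0 g1 gZ] := block iA; split=> // hg.
(* The full gain [h] needs a block of size at least [Z], leaving at most m - Z = r units for
   stars. *)
have : Z <= n i by rewrite leqNgt; apply/negP => /gZ; lia.
by move: em; rewrite ek; lia.
Qed.

End GainSum.

(** * Star components and the upper bound *)

Lemma lnu_cover (G : sgraph) (P : {set {set G}}) :
  trivIset P -> \sum_(B in P) lnu B <= lnu (cover P).
Proof.
have [n] := ubnP #|P|; elim: n P => // n IH P leP tiP.
have [->|/set0Pn[B BP]] := eqVneq P set0; first by rewrite big_set0.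
rewrite (big_setD1 B) //=; have leP' : #|P :\ B| < n by move: leP; rewrite (cardsD1 B P) BP.
apply: leq_trans (leq_add (leqnn _) (IH _ leP' (trivIsetS (subsetDl _ _) tiP))) _.
have -> : cover P = B :|: cover (P :\ B) by rewrite /cover (big_setD1 B).
apply: lnu_disjoint; rewrite bigcup_disjoint // => A /setD1P[AB AP].
by rewrite (trivIsetP tiP) // eq_sym.
Qed.

Section Components.
Variable G : sgraph.
Implicit Types (x y z : G) (S : {set G}).

Lemma connect_adj_sym : connect_sym (@adj G).
Proof. exact/sym_connect_sym/adj_sym. Qed.

Lemma componentE S x : S \in components G -> x \in S -> S = [set y | connect (@adj G) x y].
Proof.
case/imsetP => z _ ->; rewrite inE => zx; apply/setP => y; rewrite !inE.
exact: (same_connect connect_adj_sym zx).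
Qed.

Lemma component_adj S x y : S \in components G -> x -- y -> (x \in S) = (y \in S).
Proof.
move=> SC xy; apply/idP/idP => [xS|yS].
  by rewrite (componentE SC xS) inE connect1.
by rewrite (componentE SC yS) inE connect1 // adj_sym.
Qed.

Lemma trivIset_components : trivIset (components G).
Proof.
apply/trivIsetP => A B AC BC; apply: contraR => /pred0Pn[z /= /andP[zA zB]].
by rewrite (componentE AC zA) (componentE BC zB).
Qed.

Variable d : nat.
Hypotheses (d0 : 0 < d) (hd : forall x, deg x <= d).

(** The centre has degree at most [d], and each of the [d] leaves has only the centre as neighbour
    because no edge leaves a component. *)
Lemma star_component S : S \in components G -> isomorphic (induced S) (star d) ->
  \sum_(x in S) deg x <= 2 * d /\ 2 <= lnu S.
Proof.
move=> SC [f bij_f fadj]; have [f' fK f'K] := bij_f.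
have cS : #|S| = d.+1.
  by rewrite -card_induced (bij_eq_card bij_f) card_option card_ord.
pose c := f' None; pose l := f' (Some (Ordinal d0)).
have cl : val c -- val l.
  by change (c -- l); rewrite -fadj !f'K.
split; last exact: lnu_adj (valP c) (valP l) cl.
rewrite (big_setD1 (val c)) ?(valP c) //= mul2n -addnn leq_add //.
have -> : d = \sum_(y in S :\ val c) 1.
  by rewrite sum1_card; have := cardsD1 (val c) S; rewrite (valP c) cS; lia.
apply: leq_sum => y /setD1P[yc yS]; rewrite -(cards1 (val c)).
apply: subset_leq_card; apply/subsetP => z; rewrite !inE => yz.
have zS : z \in S by rewrite -(component_adj SC yz).
pose y' : induced S := Sub y yS; pose z' : induced S := Sub z zS.
have : f y' -- f z' by rewrite fadj.
have fy : f y' != None.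
  by apply: contraNneq yc => E; rewrite /c -E fK.
change (f y' -- f z') with ((f y' == None) (+) (f z' == None)).
rewrite (negbTE fy) /= => /eqP E.
by rewrite -[z]/(val z') /c -E fK.
Qed.

(** [T] is the set of vertices outside all star components; each star accounts for at most [d] edges
    and contributes an edge to a matching. *)
Lemma star_components_split : exists T : {set G},
  #|edges G| <= inner T + d * star_components d G /\
  lnu T + 2 * star_components d G <= 2 * matching_number G.
Proof.
rewrite /star_components; set Q := [set S in _ | _].
have QC S : S \in Q -> S \in components G by rewrite inE => /andP[].
have Qstar S : S \in Q -> \sum_(x in S) deg x <= 2 * d /\ 2 <= lnu S.
  by rewrite inE => /andP[SC /asboolP]; apply: star_component.
have tiQ : trivIset Q by apply: trivIsetS trivIset_components; apply/subsetP.
exists (~: cover Q); split.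
  rewrite -(leq_pmul2l (ltn0Sn 1)) -handshake mulnDr -handshake_inner.
  rewrite (bigID [in cover Q]) /= addnC leq_add //.
    rewrite leq_eqVlt; apply/orP; left; apply/eqP.
    apply: eq_big => x; first by rewrite inE.
    move=> xQ; apply: eq_card => y; rewrite !inE; have [xy|] := boolP (x -- y); last by rewrite andbF.
    rewrite andbT; apply/esym/negP => /bigcupP[S SQ yS]; case/negP: xQ.
    by apply/bigcupP; exists S; rewrite // (component_adj (QC S SQ) xy).
  rewrite big_trivIset //= (_ : 2 * (d * #|Q|) = #|Q| * (2 * d)); last by lia.
  by rewrite -sum_nat_const; apply: leq_sum => S /Qstar[].
apply: leq_trans (lnu_matching_number [set: G]).
rewrite -(setUCr (cover Q)) addnC setUC.
have dQ : [disjoint ~: cover Q & cover Q] by rewrite disjoint_sym -setI_eq0 setICr.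
apply: leq_trans (lnu_disjoint dQ); rewrite addnC leq_add2l.
apply: leq_trans (lnu_cover tiQ).
by rewrite mulnC -sum_nat_const; apply: leq_sum => S /Qstar[].
Qed.

End Components.

(** A star uses one unit of the budget [m] and brings [d] edges, the rate of a block without gain,
    so stars and blocks enter one common estimate. *)
Lemma edges_bound (d m k r : nat) (H : sgraph) : 2 <= d -> d <= Ztri d ->
    m = k * Ztri d + r -> r < Ztri d ->
    m <= d \/ (Ztri d = d \/ Ztri d = d.+1 /\ 2 <= d./2) \/ Ztri d <= m < 2 * d ->
    Mtri d m H ->
  #|edges H| <= d * m + (k * d./2 + (d <= r)) /\
  (#|edges H| = d * m + (k * d./2 + (d <= r)) ->
   star_components d H <= (if r < d then r else 0)).
Proof.
move=> d2 dZ em rZ hcase [tf hD hm].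
have hd (x : H) : deg x <= d by apply: leq_trans hD; exact: (@leq_bigmax _ (@deg H) x).
have [T [eT nT]] := star_components_split (ltnW d2) hd.
have [P [n [c [leT leN block]]]] := edge_gain T d2 tf hd.
set s := star_components d H in eT nT *.
have total : c + \sum_(B in P) n B + s <= m by lia.
have [b1 b2] := gain_sum_bound block (ltnW d2) ltac:(lia) dZ em rZ total hcase.
have le : #|edges H| <= d * m + \sum_(B in P) gain d B.
  apply: leq_trans eT _; apply: leq_trans (leq_add leT (leqnn _)) _.
  have : d * (c + \sum_(B in P) n B + s) <= d * m by rewrite leq_mul2l total orbT.
  by rewrite [in X in X -> _]mulnDr; lia.
split; first by lia.
by move=> E; apply: b2; lia.
Qed.

(** * Bounds on Z(d) *)

Section Table.
Variables (n : nat) (t : seq (seq nat)).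
Let N := (2 * n).+1.

(** Entries must occur in both directions and off the diagonal, so every table yields a simple
    graph. *)
Definition tadj (x y : nat) : bool :=
  [&& x != y, y \in nth [::] t x & x \in nth [::] t y].

Let table_adj : rel 'I_N := fun x y => tadj x y.
Fact table_sym : symmetric table_adj.
Proof. by move=> x y; rewrite /table_adj /tadj eq_sym; congr andb; rewrite andbC. Qed.
Fact table_irr : irreflexive table_adj.
Proof. by move=> x; rewrite /table_adj /tadj eqxx. Qed.
Definition table_graph : sgraph := SGraph table_sym table_irr.

(* The tables used below contain the Hamiltonian cycle 0, 1, ..., 2n; this is the
   perfect matching of the path that remains when v is deleted from it. *)
Definition cycle_mate (v x : nat) : nat :=
  if odd ((x + N - v) %% N) then x.+1 %% N else (x + N.-1) %% N.

(* x0 is the vertex of smaller degree; it is irrelevant when d is even. *)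
Definition table_check (d x0 : nat) : bool :=
  let s := iota 0 N in
  [&& x0 < N,
      all (fun x => all (fun y => all (fun z =>
        ~~ [&& tadj x y, tadj y z & tadj x z]) s) s) s,
      all (fun v => all (fun x => (x != v) ==>
        [&& cycle_mate v x < N, cycle_mate v x != v,
            cycle_mate v (cycle_mate v x) == x & tadj x (cycle_mate v x)]) s) s
    & all (fun x => count (tadj x) s == d - (odd d && (x == x0))) s].

Lemma table_deg (x : table_graph) : deg x = count (tadj (val x)) (iota 0 N).
Proof.
rewrite /deg cardsE cardE size_filter -(count_map val (tadj (val x))).
by rewrite -enumT val_enum_ord.
Qed.

Lemma table_critical d x0 : table_check d x0 -> critical_regular d n table_graph.
Proof.
case/and4P => x0N tri mates degs.
have mem (x : table_graph) : val x \in iota 0 N by rewrite mem_iota /= ltn_ord.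
have cN : #|table_graph| = 2 * n + 1 by rewrite card_ord addn1.
have hdeg (x : table_graph) : deg x = d - (odd d && (val x == x0)).
  by rewrite table_deg; apply/eqP; apply: (allP degs).
have [] := @mates_critical table_graph n cN.
  move=> v; exists (fun x => inord (cycle_mate (val v) (val x)) : 'I_N) => x xv.
  have := allP (allP mates _ (mem v)) _ (mem x); rewrite xv /=.
  case/and4P => mN mv mm mx.
  have E : val (inord (cycle_mate (val v) (val x)) : 'I_N) = cycle_mate (val v) (val x).
    by rewrite /= inordK.
  split.
  - by apply: contraNneq mv => Ev; rewrite -E Ev.
  - by apply: val_inj; rewrite E (eqP mm) /= inordK.
  - by change (tadj (val x) (val (inord (cycle_mate (val v) (val x)) : 'I_N))); rewrite E.
move=> fc nu; split=> //.
  move=> x y z [xy yz xz].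
  have := allP (allP (allP tri _ (mem x)) _ (mem y)) _ (mem z).
  by rewrite -[tadj _ _]/(x -- y) xy -[tadj _ _]/(y -- z) yz -[tadj _ _]/(x -- z) xz.
case: ifP => od; last by move=> x; rewrite hdeg od subn0.
exists (Ordinal x0N : table_graph); split; first by rewrite hdeg od eqxx subn1.
move=> y yx; rewrite hdeg od.
by rewrite (_ : (val y == x0) = false) ?subn0 //; apply: contraNF yx.
Qed.

End Table.

(** To survive the symmetry test of [tadj], a residue must be listed in [c] together with its
    negative. *)
Definition circulant_table (N : nat) (c : seq nat) : seq (seq nat) :=
  [seq [seq (x + i) %% N | i <- c] | x <- iota 0 N].

(** Explicit graphs on 5, 7, 11, 13 and 15 vertices for d = 2, ..., 6, checked by computation. The
    clause [4 <= d] ensures floor(d/2) >= 2, which superadditivity needs when Z(d) = d+1. *)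
Lemma Ztri_le d : 2 <= d <= 6 -> Ztri d <= d \/ 4 <= d /\ Ztri d <= d.+1.
Proof.
case/andP => d2 d6; have [_ _ minZ] := ZtriP d2.
move: d2 d6 minZ; case: d => [|[|[|[|[|[|[|d]]]]]]] // _ _ minZ.
- left; apply: (minZ 2 (table_graph 2 (circulant_table 5 [:: 1; 4]))) => //.
  by apply: (@table_critical _ _ _ 0); vm_compute.
- left; apply: (minZ 3 (table_graph 3
    [:: [:: 1; 3; 6]; [:: 0; 2; 4]; [:: 1; 3; 5]; [:: 0; 2; 4]; [:: 1; 3; 5];
        [:: 2; 4; 6]; [:: 0; 5]])) => //.
  by apply: (@table_critical _ _ _ 6); vm_compute.
- right; split=> //; apply: (minZ 5 (table_graph 5 (circulant_table 11 [:: 1; 3; 8; 10]))) => //.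
  by apply: (@table_critical _ _ _ 0); vm_compute.
- right; split=> //; apply: (minZ 6 (table_graph 6
    [:: [:: 1; 3; 7; 10; 12]; [:: 0; 2; 5; 9; 11]; [:: 1; 3; 7; 10; 12];
        [:: 0; 2; 4; 6; 11]; [:: 3; 5; 7; 9; 12]; [:: 1; 4; 6; 8; 10];
        [:: 3; 5; 7; 9; 12]; [:: 0; 2; 4; 6; 8]; [:: 5; 7; 9; 11];
        [:: 1; 4; 6; 8; 10]; [:: 0; 2; 5; 9; 11]; [:: 1; 3; 8; 10; 12];
        [:: 0; 2; 4; 6; 11]])) => //.
  by apply: (@table_critical _ _ _ 8); vm_compute.
- right; split=> //.
  apply: (minZ 7 (table_graph 7 (circulant_table 15 [:: 1; 4; 6; 9; 11; 14]))) => //.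
  by apply: (@table_critical _ _ _ 0); vm_compute.
Qed.

(** A perfect matching of [C] minus a vertex is also a matching of [C], so |C| is odd and at most
    2n+1, while it is at least 2n. Positivity of [n] excludes the empty graph, which is vacuously
    factor-critical. *)
Lemma factor_critical_card (C : sgraph) n : 0 < n ->
  factor_critical C -> matching_number C = n -> #|C| = 2 * n + 1.
Proof.
move=> n0 fc nu; have [M mM cM] := matching_number_attained C.
have cM2 := card_cover_matching mM.
have /card_gt0P[v _] : 0 < #|C|.
  by have := subset_leq_card (subsetT (cover M)); rewrite cardsT; lia.
have [M' /andP[mM' /eqP covM']] := fc v.
have c1 := card_cover_matching mM'; rewrite covM' cardsT in c1.
have c2 : #|induced [set~ v]| = #|C|.-1 by rewrite card_induced cardsC1.
have {}c2 : #|C| = 2 * #|M'| + 1.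
  have : 0 < #|C| by apply/card_gt0P; exists v.
  by move: c1; rewrite c2; lia.
suff : #|M'| <= n.
  have : 2 * n <= #|C|.
    by have := subset_leq_card (subsetT (cover M)); rewrite cardsT; lia.
  by lia.
have [sM' tM'] := andP mM'.
pose i (e : {set induced [set~ v]}) : {set C} := val @: e.
have inj_i : injective i by apply: imset_inj; exact: val_inj.
rewrite -nu -(card_imset _ inj_i); apply: leq_matching_number; apply/andP; split.
  apply/subsetP => _ /imsetP[e eM ->]; have [x [y [xy ->]]] := edgeP _ (subsetP sM' e eM).
  by apply/edgeP; exists (val x), (val y); split; rewrite // /i imsetU1 imset_set1.
apply/trivIsetP => _ _ /imsetP[e eM ->] /imsetP[e' eM' ->] ne.
rewrite -setI_eq0 -imsetI; last by move=> ? ? _ _; exact: val_inj.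
have : [disjoint e & e'] by apply: (trivIsetP tM') => //; apply: contraNneq ne => ->.
by rewrite -setI_eq0 => /eqP->; rewrite imset0.
Qed.

Lemma critical_regular_sum d n (C : sgraph) : 0 < d -> 0 < n ->
  critical_regular d n C -> \sum_(x : C) deg x = 2 * (d * n + d./2).
Proof.
move=> d0 n0 [tf fc nu reg]; have cC := factor_critical_card n0 fc nu.
case: ifP reg => od; last first.
  move=> reg; rewrite (eq_bigr (fun=> d)) => [|x _]; last exact: reg.
  by rewrite sum_nat_const -[#|_|]/#|C| cC; nia.
case=> x [dx dy]; rewrite (bigD1 x) //= (eq_bigr (fun=> d)) => [|y yx]; last exact: dy.
by rewrite sum_nat_const dx -[#|_|]/#|predC1 x| cardC1 cC; nia.
Qed.

(** For Z(d) < d Mantel's bound allows only d Z(d) edges, fewer than the degrees require. *)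
Lemma Ztri_ge d : 2 <= d -> d <= Ztri d.
Proof.
move=> d2; have [Z0 [C cC] _] := ZtriP d2.
have [tf fc nu reg] := cC; have c := factor_critical_card Z0 fc nu.
have := critical_regular_sum (ltnW d2) Z0 cC.
rewrite leqNgt handshake => E; apply/negP => Zd.
have := @inner_lt_degree C d tf [set: C] (Ztri d); rewrite cardsT c => /(_ erefl Zd).
rewrite (_ : inner _ = #|edges C|); first by lia.
by apply: eq_card => e; rewrite !inE subsetT andbT.
Qed.

(** * The extremal graphs *)

(** Pulls the part of a matching inside an embedded copy back to that copy; it bounds matchings of
    disjoint unions summand by summand. *)
Lemma matching_embed (X W : sgraph) (i : X -> W) (M : {set {set W}}) :
    injective i -> (forall x y, i x -- i y -> x -- y) -> matching M ->
  #|[set e in M | e \subset codom i]| <= matching_number X.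
Proof.
move=> inj_i adj_i /andP[sM tM]; pose p (e : {set W}) : {set X} := i @^-1: e.
rewrite -(@card_in_imset _ _ p); last first.
  move=> e e'; rewrite !inE => /andP[_ ei] /andP[_ ei'] E.
  apply/setP => w; apply/idP/idP => we.
    have /codomP[x ex] := subsetP ei w we.
    by have : x \in p e'; [rewrite -E inE -ex | rewrite inE -ex].
  have /codomP[x ex] := subsetP ei' w we.
  by have : x \in p e; [rewrite E inE -ex | rewrite inE -ex].
apply: leq_matching_number; apply/andP; split.
  apply/subsetP => _ /imsetP[e + ->]; rewrite inE => /andP[eM ei].
  have [a [b [ab E]]] := edgeP _ (subsetP sM e eM).
  have /codomP[x ex] : a \in codom i by apply: (subsetP ei); rewrite E set21.
  have /codomP[y ey] : b \in codom i by apply: (subsetP ei); rewrite E set22.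
  apply/edgeP; exists x, y; split; first by apply: adj_i; rewrite -ex -ey.
  by apply/setP => z; rewrite E !inE ex ey !(inj_eq inj_i).
apply/trivIsetP => _ _ /imsetP[e + ->] /imsetP[e' + ->].
rewrite !inE => /andP[eM _] /andP[eM' _] ne.
have : [disjoint e & e'] by apply: (trivIsetP tM) => //; apply: contraNneq ne => ->.
by rewrite -!setI_eq0 -preimsetI => /eqP->; rewrite preimset0.
Qed.

Section Dunion.
Variables X Y : sgraph.

Lemma dunion_adj_l (x y : X) : ((inl x : dunion X Y) -- inl y) = (x -- y).
Proof. by []. Qed.

Lemma dunion_adj_r (x y : Y) : ((inr x : dunion X Y) -- inr y) = (x -- y).
Proof. by []. Qed.

Lemma dunion_deg_l (x : X) : deg (inl x : dunion X Y) = deg x.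
Proof.
have inj : injective (inl : X -> dunion X Y) by move=> ? ? [].
rewrite /deg -(card_imset _ inj); apply: eq_card => -[y|y]; rewrite inE.
  by rewrite (mem_imset _ _ inj) inE.
by apply/idP/imsetP => [//|[]].
Qed.

Lemma dunion_deg_r (x : Y) : deg (inr x : dunion X Y) = deg x.
Proof.
have inj : injective (inr : Y -> dunion X Y) by move=> ? ? [].
rewrite /deg -(card_imset _ inj); apply: eq_card => -[y|y]; rewrite inE.
  by apply/idP/imsetP => [//|[]].
by rewrite (mem_imset _ _ inj) inE.
Qed.

Lemma dunion_triangle_free :
  triangle_free X -> triangle_free Y -> triangle_free (dunion X Y).
Proof.
move=> tX tY [x|x] [y|y] [z|z] [] //; rewrite ?dunion_adj_l ?dunion_adj_r => xy yz xz.
  exact: (tX x y z).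
exact: (tY x y z).
Qed.

Lemma dunion_no_isolated : no_isolated X -> no_isolated Y -> no_isolated (dunion X Y).
Proof. by move=> iX iY [x|x]; rewrite ?dunion_deg_l ?dunion_deg_r. Qed.

Lemma dunion_deg_le d : (forall x : X, deg x <= d) -> (forall y : Y, deg y <= d) ->
  forall u : dunion X Y, deg u <= d.
Proof. by move=> hX hY [x|x]; rewrite ?dunion_deg_l ?dunion_deg_r. Qed.

Lemma dunion_deg_sum :
  \sum_(u : dunion X Y) deg u = \sum_(x : X) deg x + \sum_(y : Y) deg y.
Proof.
rewrite big_sumType /=; congr addn; apply: eq_bigr => x _.
  exact: dunion_deg_l.
exact: dunion_deg_r.
Qed.

Lemma dunion_matching :
  matching_number (dunion X Y) <= matching_number X + matching_number Y.
Proof.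
have [M mM <-] := matching_number_attained (dunion X Y); have /andP[sM _] := mM.
pose il : X -> dunion X Y := inl; pose ir : Y -> dunion X Y := inr.
have : M \subset [set e in M | e \subset codom il] :|: [set e in M | e \subset codom ir].
  apply/subsetP => e eM; rewrite in_setU !in_set eM !andTb.
  have [[x|x] [[y|y] [xy ->]]] := edgeP _ (subsetP sM e eM); move: xy => // _.
    by apply/orP; left; apply/subsetP => z /set2P[]->; apply: (codom_f il).
  by apply/orP; right; apply/subsetP => z /set2P[]->; apply: (codom_f ir).
move=> /subset_leq_card/leq_trans; apply; apply: leq_trans (leq_card_setU _ _) _.
by apply: leq_add; apply: matching_embed => // ? ? [].
Qed.

End Dunion.

Section Copies.
Variables (k : nat) (X : sgraph).

Lemma copies_adjE (i j : 'I_k) (x y : X) :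
  (((i, x) : copies k X) -- (j, y)) = (i == j) && (x -- y).
Proof. by []. Qed.

Lemma copies_deg (i : 'I_k) (x : X) : deg ((i, x) : copies k X) = deg x.
Proof.
have inj : injective (pair i : X -> copies k X) by move=> ? ? [].
rewrite /deg -(card_imset _ inj); apply: eq_card => -[j y]; rewrite inE copies_adjE.
apply/andP/imsetP => [[/eqP<- xy]|[z]]; first by exists y; rewrite ?inE.
by rewrite inE => xz [-> ->].
Qed.

Lemma copies_triangle_free : triangle_free X -> triangle_free (copies k X).
Proof.
move=> tX [i x] [j y] [l z]; rewrite !copies_adjE.
by case=> /andP[_ xy] /andP[_ yz] /andP[_ xz]; apply: (tX x y z).
Qed.

Lemma copies_deg_sum : \sum_(u : copies k X) deg u = k * \sum_(x : X) deg x.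
Proof.
transitivity (\sum_(i < k) \sum_(x : X) deg x); last by rewrite sum_nat_const card_ord.
by rewrite pair_bigA; apply: eq_bigr => -[i x] _; apply: copies_deg.
Qed.

Lemma copies_matching : matching_number (copies k X) <= k * matching_number X.
Proof.
have [M mM <-] := matching_number_attained (copies k X); have /andP[sM _] := mM.
pose il i : X -> copies k X := pair i.
have : M \subset \bigcup_(i < k) [set e in M | e \subset codom (il i)].
  apply/subsetP => e eM; have [[i x] [[j y] []]] := edgeP _ (subsetP sM e eM).
  rewrite copies_adjE => /andP[/eqP<- xy] E; apply/bigcupP; exists i => //.
  by rewrite inE eM E; apply/subsetP => z /set2P[]->; apply: (codom_f (il i)).
move=> /subset_leq_card/leq_trans; apply.
apply: (@leq_trans (\sum_(i < k) matching_number X)); last first.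
  by rewrite sum_nat_const card_ord.
elim/big_rec2: _ => [|i a A _ le]; first by rewrite cards0.
apply: leq_trans (leq_card_setU _ _) _; apply: leq_add => //.
apply: matching_embed => //; first by move=> ? ? [].
by move=> x y; rewrite copies_adjE => /andP[].
Qed.

End Copies.

Section StarGraph.
Variable d : nat.

Lemma star_adjE (u v : star d) : (u -- v) = (u == None) (+) (v == None).
Proof. by []. Qed.

Lemma star_deg (u : star d) : deg u = if u == None then d else 1.
Proof.
case: u => [a|]; rewrite [RHS]/= /deg.
  rewrite -(cards1 (None : star d)); apply: eq_card => v.
  by rewrite in_set1 in_set star_adjE.
transitivity #|(Some : 'I_d -> star d) @: [set: 'I_d]|; last first.
  by rewrite card_imset ?cardsT ?card_ord //; exact: Some_inj.
apply: eq_card => -[b|]; rewrite inE star_adjE /=.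
  by rewrite (mem_imset _ _ Some_inj) inE.
by apply/idP/imsetP => [//|[]].
Qed.

Lemma star_triangle_free : triangle_free (star d).
Proof.
move=> u v w; rewrite !star_adjE.
by case: (u == None); case: (v == None); case: (w == None); case.
Qed.

Lemma star_deg_sum : \sum_(u : star d) deg u = 2 * d.
Proof.
rewrite (bigD1 None) //= star_deg eqxx (eq_bigr (fun=> 1)).
  by rewrite sum1_card cardC1 card_option card_ord; lia.
by move=> u /negbTE nu; rewrite star_deg nu.
Qed.

Lemma star_matching : matching_number (star d) <= 1.
Proof.
have [M /andP[sM tM] <-] := matching_number_attained (star d).
have center e : e \in M -> None \in e.
  move=> eM; have [u [v [uv ->]]] := edgeP _ (subsetP sM e eM).
  by move: uv; rewrite star_adjE !inE !(eq_sym None); case: (u == None).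
apply/card_le1_eqP => e e' eM eM'; apply: contraTeq isT => ne.
have /pred0P/(_ None) := trivIsetP tM _ _ eM' eM ne.
by rewrite /= !center.
Qed.

End StarGraph.

Section BlowupGraph.
Variables (X : sgraph) (s : X -> nat).

Lemma blowup_card : #|blowup s| = \sum_x s x.
Proof. by rewrite card_tagged sumnE big_map enumT; apply: eq_bigr => x _; rewrite card_ord. Qed.

Lemma blowup_deg (u : blowup s) : deg u = \sum_(y | tag u -- y) s y.
Proof.
rewrite /deg -sum1dep_card.
rewrite (eq_bigr (fun y => \sum_(a : 'I_(s y)) 1)); last first.
  by move=> y _; rewrite sum1_card card_ord.
rewrite sig_big_dep /=; apply: eq_bigl => v; rewrite andbT //.
Qed.

Lemma blowup_deg_sum : \sum_(u : blowup s) deg u = \sum_x s x * \sum_(y | x -- y) s y.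
Proof.
transitivity (\sum_x \sum_(a : 'I_(s x)) \sum_(y | x -- y) s y).
  by rewrite sig_big_dep; apply: eq_bigr => u _; apply: blowup_deg.
by apply: eq_bigr => x _; rewrite sum_nat_const card_ord.
Qed.

Lemma blowup_triangle_free : triangle_free X -> triangle_free (blowup s).
Proof. by move=> tX u v w; apply: (tX (tag u) (tag v) (tag w)). Qed.

End BlowupGraph.

Lemma cycle5_triangle_free : triangle_free cycle5.
Proof.
case=> [[|[|[|[|[|//]]]]] hx] [[|[|[|[|[|//]]]]] hy] [[|[|[|[|[|//]]]]] hz] [] //.
Qed.

Section AGraph.
Variable d : nat.
Hypothesis d2 : 2 <= d.

Let size5 (i : 'I_5) : nat := nth 0 [:: 1; 1; d.-1; d.-1; 1] i.

Lemma cycle5_weight (x : cycle5) :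
  \sum_(y | x -- y) size5 y = nth 0 [:: 2; d; d; d; d] x.
Proof.
rewrite big_mkcond (eq_bigr (fun y : 'I_5 =>
  if (y == x.+1 %% 5 :> nat) || (x == y.+1 %% 5 :> nat) then size5 y else 0)) //.
by rewrite !big_ord_recl big_ord0 /size5; case: x => [[|[|[|[|[|//]]]]] hx] /=; lia.
Qed.

Lemma Agraph_deg (u : Agraph d) : deg u = nth 0 [:: 2; d; d; d; d] (tag u : 'I_5).
Proof. by rewrite blowup_deg cycle5_weight. Qed.

Lemma Agraph_deg_le (u : Agraph d) : 0 < deg u <= d.
Proof. by rewrite Agraph_deg; case: (tag u) => [[|[|[|[|[|//]]]]] hx] /=; lia. Qed.

(** One vertex has degree 2 and the other 2d have degree [d], so the graph attains the bound of
    [inner_eq_degree]. *)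
Lemma Agraph_deg_sum : \sum_(u : Agraph d) deg u = 2 * (d * d + 1).
Proof.
rewrite blowup_deg_sum (eq_bigr _ (fun x _ => congr1 _ (cycle5_weight x))).
by rewrite !big_ord_recl big_ord0 /size5 /=; nia.
Qed.

Lemma Agraph_matching : matching_number (Agraph d) <= d.
Proof.
apply: matching_number_half; rewrite blowup_card !big_ord_recl big_ord0 /=; lia.
Qed.

Lemma Agraph_triangle_free : triangle_free (Agraph d).
Proof. exact/blowup_triangle_free/cycle5_triangle_free. Qed.

End AGraph.

Section StarCopies.
Variables (X : sgraph) (d r : nat).
Let W := dunion X (copies r (star d)).

(** A lower bound suffices, since [edges_bound] limits the star components of every competitor. *)
Lemma star_copies_components : r <= star_components d W.
Proof.
pose e (i : 'I_r) (x : star d) : W := inr (i, x).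
have inj_e i : injective (e i) by move=> x y [].
pose S i : {set W} := [set e i x | x : star d].
have SP i u : reflect (exists x, u = e i x) (u \in S i).
  by apply: (iffP imsetP) => [[x _ ->]|[x ->]]; exists x.
have injS : injective S.
  move=> i j E; have : e i None \in S j by rewrite -E; apply/SP; exists None.
  by case/SP => x [].
rewrite -[r in r <= _]card_ord -cardsT -(card_imset _ injS).
apply: subset_leq_card; apply/subsetP => _ /imsetP[i _ ->].
rewrite inE; apply/andP; split.
  apply/imsetP; exists (e i None) => //; apply/setP => u; rewrite inE.
  have cl : closed (@adj W) (S i).
    apply: (intro_closed (@connect_adj_sym W)) => w v wv /SP[x ew].
    move: wv; rewrite ew; case: v => // -[j y]; rewrite dunion_adj_r copies_adjE => /andP[/eqP ij _].
    by apply/SP; exists y; rewrite /e ij.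
  apply/idP/idP => [/SP[x ->]|/(closed_connect cl) <-]; last by apply/SP; exists None.
  case: x => [a|]; last exact: connect0.
  by apply: connect1; rewrite dunion_adj_r copies_adjE eqxx.
apply/asboolP.
have eS x : e i x \in S i by apply/SP; exists x.
pose f (u : induced (S i)) : star d := if val u is inr (_, x) then x else None.
have fE u : val u = e i (f u).
  by rewrite /f; case: u => u uS /=; case/SP: (uS) => x ->.
exists f.
  exists (fun x => Sub (e i x) (eS x) : induced (S i)) => [u|x] //.
  by apply: val_inj; rewrite [RHS]fE.
move=> u v; change (u -- v) with (val u -- val v); rewrite !fE.
by rewrite dunion_adj_r copies_adjE eqxx.
Qed.

End StarCopies.

(** * Optimality of the disjoint unions *)

Lemma ftri_unique d m n : (forall G, Mtri d m G -> #|edges G| <= n) ->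
  (exists2 G, Mtri d m G & #|edges G| = n) -> ftri d m = n.
Proof.
move=> ub [G hG eG]; rewrite /ftri; case: ex_maxnP => z /asboolP[H hH <-] zmax.
apply/eqP; rewrite eqn_leq ub //=; apply: zmax; apply/asboolP.
by exists G.
Qed.

Lemma critical_regular_deg d n (C : sgraph) (x : C) :
  2 <= d -> critical_regular d n C -> 0 < deg x <= d.
Proof.
move=> d2 [_ _ _]; case: ifP => _; last by move=> ->; lia.
by case=> y [dy dz]; have [->|/dz->] := eqVneq x y; lia.
Qed.

Lemma dunion_critical_Mtri d k n r (C Y : sgraph) : 2 <= d ->
    critical_regular d n C -> Mtri d r Y -> Mtri d (k * n + r) (dunion (copies k C) Y).
Proof.
move=> d2 cC [tY dY nY]; have [tC _ nC _] := cC; split.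
- exact/dunion_triangle_free/tY/copies_triangle_free.
- apply/bigmax_leqP => u _; apply: dunion_deg_le => [[i x]|y].
    by rewrite copies_deg; have /andP[] := critical_regular_deg x d2 cC.
  by apply: leq_trans dY; exact: (@leq_bigmax _ (@deg Y) y).
apply: leq_trans (dunion_matching _ _) _; apply: leq_add => //.
by rewrite -nC; apply: copies_matching.
Qed.

Lemma dunion_critical_edges d k n e (C Y : sgraph) : 0 < d -> 0 < n ->
    critical_regular d n C -> \sum_(y : Y) deg y = 2 * e ->
  #|edges (dunion (copies k C) Y)| = d * (k * n) + k * d./2 + e.
Proof.
move=> d0 n0 cC sY; have := handshake (dunion (copies k C) Y).
rewrite dunion_deg_sum copies_deg_sum (critical_regular_sum d0 n0 cC) sY.
by clear; nia.
Qed.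

Theorem theorem8 (d m k r : nat) (hd : 2 <= d) (hm : 1 <= m)
    (hkr : m = k * Ztri d + r) (hr : r < Ztri d)
    (hcase : d >= m \/ (d < m /\ d <= 6) \/ (d < m /\ Ztri d <= m < 2 * d)) :
  ftri d m = (if r < d then d * m + k * d./2 else d * m + k * d./2 + r - d + 1) /\
  (exists C : sgraph, critical_regular d (Ztri d) C) /\
  (forall C : sgraph, critical_regular d (Ztri d) C ->
     Gtri d m (dunion (copies k C)
                      (if r < d then copies r (star d) else Agraph d))).
Proof.
have [Z0 exC _] := ZtriP hd; have dZ := Ztri_ge hd.
have hZ : m <= d \/ (Ztri d = d \/ Ztri d = d.+1 /\ 2 <= d./2) \/ Ztri d <= m < 2 * d.
  case: hcase => [?|[[_ d6]|[_ ?]]]; [by left | right; left | by right; right].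
  by case: (@Ztri_le d); rewrite ?hd //; lia.
(* In each case r >= d leaves only r = d, so the correction r - d + 1 equals 1 and both formulas
   agree with [V]. *)
have rd : d <= r -> r = d.
  have rm : r <= m by rewrite hkr leq_addl.
  case: hZ => [|[|/andP[Zm m2]]] dr; [lia | lia |].
  move: hkr; case: (k) => [|j]; rewrite ?mulSn; lia.
pose V := d * m + (k * d./2 + (d <= r)).
have eV : (if r < d then d * m + k * d./2 else d * m + k * d./2 + r - d + 1) = V.
  by rewrite /V; case: ltnP => [|/rd]; lia.
pose Y := if r < d then copies r (star d) else Agraph d.
have [tY dY nY sY] : [/\ triangle_free Y, forall y : Y, 0 < deg y <= d,
    matching_number Y <= r & \sum_(y : Y) deg y = 2 * (d * r + (d <= r))].
  rewrite /Y; case: ltnP => [_|dr].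
    split.
    - exact/copies_triangle_free/star_triangle_free.
    - by move=> [i u]; rewrite copies_deg star_deg; case: ifP; lia.
    - apply: leq_trans (copies_matching _ _) _; rewrite -[X in _ <= X]muln1.
      by rewrite leq_mul2l star_matching orbT.
    - by rewrite copies_deg_sum star_deg_sum addn0; lia.
  split; [exact: Agraph_triangle_free | exact: Agraph_deg_le | |].
    by apply: leq_trans (Agraph_matching hd) _.
  by rewrite Agraph_deg_sum // (rd dr).
have mY : Mtri d r Y by split=> //; apply/bigmax_leqP => y _; have /andP[] := dY y.
have mtri C : critical_regular d (Ztri d) C -> Mtri d m (dunion (copies k C) Y).
  by move=> cC; rewrite hkr; apply: dunion_critical_Mtri.
have edgesW C : critical_regular d (Ztri d) C -> #|edges (dunion (copies k C) Y)| = V.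
  by move=> cC; rewrite (dunion_critical_edges k (ltnW hd) Z0 cC sY) /V hkr; lia.
have eF : ftri d m = V.
  apply: ftri_unique => [G hG|]; first by have [] := edges_bound hd dZ hkr hr hZ hG.
  by have [C cC] := exC; exists (dunion (copies k C) Y); [apply: mtri | apply: edgesW].
split; first by rewrite eV.
split=> // C cC; split.
  split; [exact: mtri | by rewrite eF edgesW |].
  apply: dunion_no_isolated => [[i x]|y]; last by have /andP[] := dY y.
  by rewrite copies_deg; have /andP[] := critical_regular_deg x hd cC.
(* A competitor [H] attains the edge bound, so it has at most r star components if r < d and none
   otherwise. *)
move=> H [hH eH _]; have [_ /(_ _)] := edges_bound hd dZ hkr hr hZ hH.
rewrite eH eF => /(_ erefl)/leq_trans; apply.
rewrite /Y; case: ifP => // _; exact: star_copies_components.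
Qed.
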